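(* Let $n$ and $\gamma$ be positive integers with $n\ge 3\gamma-2$. Let $G$ be a minimizing graph among all connected graphs of order $n$ and domination number $\gamma$, i.e. $G$ is a graph in this class whose algebraic connectivity attains the minimum over the class. Then $G$ is one of the following graphs: (1) if $\gamma=1$, then $G$ contains a cut vertex that is adjacent to all other vertices of $G$; (2) if $\gamma\ge 2$, then $G$ is (up to isomorphism) obtained from the tree $T_{3\gamma-2}$ of order $n$ by arbitrarily adding some (or no) edges among the pendant vertices in a same pendant star of $T_{3\gamma-2}$.
   Context: All graphs are finite and simple. For a graph $G$, $L(G)=D(G)-A(G)$ is its Laplacian matrix (degree matrix minus adjacency matrix), and the algebraic connectivity $\alpha(G)$ is the second smallest eigenvalue of $L(G)$ (counted with multiplicity). A set $S\subseteq V(G)$ is a dominating set if every vertex of $V(G)\setminus S$ is adjacent to at least one vertex of $S$; the domination number $\gamma(G)$ is the minimum cardinality of a dominating set of $G$. For integers $k,l\ge 0$ and $d\ge 1$, $T(k,l,d)$ is the tree of order $k+l+d$ obtained from a path $P_d$ with vertices $v_1,\ldots,v_d$ in order by attaching $k$ pendant edges at $v_1$ and $l$ pendant edges at $v_d$ (if $k=0$ or $l=0$, nothing is attached at the corresponding endpoint; if $d=1$ then $v_1=v_d$). For fixed order $n\ge d$, $T_d:=T\left(\lceil \frac{n-d}{2}\rceil,\lfloor\frac{n-d}{2}\rfloor,d\right)$. A pendant vertex is a vertex of degree 1; a quasi-pendant vertex is a vertex adjacent to a pendant vertex. A pendant star of a tree is a maximal subtree induced by pendant vertices together with the quasi-pendant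 vertex to which they all are attached.
   Formalization: In part (1) the order n is assumed to be at least 3: for γ = 1 and n = 2 the only graph is K_2, which has no cut vertex, and for n = 1 the graph K_1 has no cut vertex and no second eigenvalue. *)

(* Defs.v *)
From HB Require Import structures.
From mathcomp Require Import all_boot all_order all_algebra.
From mathcomp Require Import polyrcf.

Set Implicit Arguments.
Unset Strict Implicit.
Unset Printing Implicit Defensive.

Import Order.TTheory GRing.Theory Num.Theory.

Record sgraph := SGraph {
  vertex :> finType;
  adj : rel vertex;
  adj_sym : symmetric adj;
  adj_irrefl : irreflexive adj
}.

Definition isomorphic (G H : sgraph) : Prop :=
  exists2 f : G -> H, bijective f & {mono f : x y / adj x y}.

Definition connected (G : sgraph) : bool :=
  [forall x : G, forall y : G, connect (@adj G) x y].

Definition degree (G : sgraph) (v : G) : nat := #|[set w | adj v w]|.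

Definition dominating (G : sgraph) (S : {set G}) : bool :=
  [forall v : G, (v \notin S) ==> [exists u in S, adj v u]].

Definition domination_number (G : sgraph) : nat :=
  #|[arg min_(S < [set: G] | dominating S) #|S|]|.

Definition vertex_deleted (G : sgraph) (v : G) : rel G :=
  [rel x y | [&& x != v, y != v & adj x y]].

(* Deleting v increases the number of connected components. *)
Definition cut_vertex (G : sgraph) (v : G) : bool :=
  n_comp (@adj G) [set: G] < n_comp (vertex_deleted v) [set~ v].

Section AlgebraicConnectivity.
Local Open Scope ring_scope.
Variable R : rcfType.

Definition degree_mx (G : sgraph) : 'M[R]_#|G| :=
  diag_mx (\row_i (degree (enum_val i : G))%:R).

Definition adjacency_mx (G : sgraph) : 'M[R]_#|G| :=
  \matrix_(i, j) (adj (enum_val i : G) (enum_val j : G))%:R.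

Definition laplacian (G : sgraph) : 'M[R]_#|G| :=
  degree_mx G - adjacency_mx G.

(* rootsR lists the distinct roots in increasing order, so this is the
   nondecreasing sequence of the eigenvalues of A lying in R, each repeated
   according to its algebraic multiplicity. *)
Definition eigenvalues n (A : 'M[R]_n) : seq R :=
  flatten [seq nseq (mup x (char_poly A)) x | x <- rootsR (char_poly A)].

(* Indices start at 0.  The value is the default 0 when #|G| < 2. *)
Definition algebraic_connectivity (G : sgraph) : R :=
  (eigenvalues (laplacian G))`_1.

End AlgebraicConnectivity.

Definition conn_dom_class (n gamma : nat) (G : sgraph) : Prop :=
  [/\ #|G| = n, connected G & domination_number G = gamma].

Definition minimizing (R : rcfType) (n gamma : nat) (G : sgraph) : Prop :=
  conn_dom_class n gamma G /\
  forall H : sgraph, conn_dom_class n gamma H ->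
    (algebraic_connectivity R G <= algebraic_connectivity R H)%R.

Section DoubleBroom.
Variables k l d : nat.

(* inl i is the path vertex v_(i+1); inr (inl _) and inr (inr _) are the
   pendant vertices attached at v_1 and at v_d respectively. *)
Definition broom_vertex : finType := ('I_d + ('I_k + 'I_l))%type.

Definition broom_adj : rel broom_vertex := fun x y =>
  match x, y with
  | inl i, inl j => (i.+1 == j :> nat) || (j.+1 == i :> nat)
  | inl i, inr (inl _) | inr (inl _), inl i => i == 0 :> nat
  | inl i, inr (inr _) | inr (inr _), inl i => i.+1 == d
  | inr _, inr _ => false
  end.

Lemma broom_adj_sym : symmetric broom_adj.
Proof. by move=> [i|[i|i]] [j|[j|j]] //=; rewrite orbC. Qed.

Lemma broom_adj_irrefl : irreflexive broom_adj.
Proof. by move=> [i|[i|i]] //=; rewrite orbb; apply/negbTE; rewrite neq_ltn ltnSn orbT. Qed.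

Definition T_kld : sgraph := SGraph broom_adj_sym broom_adj_irrefl.

End DoubleBroom.

(* The tree T_d of order n, for 1 <= d <= n. *)
Definition T_order (n d : nat) : sgraph := T_kld (uphalf (n - d)) (n - d)./2 d.

Definition pendant (G : sgraph) (v : G) : bool := degree v == 1.

Definition quasi_pendant (G : sgraph) (q : G) : bool :=
  [exists p : G, pendant p && adj q p].

(* The vertex set of the pendant star at a quasi-pendant vertex q; taking all
   pendant neighbours of q is what makes the star maximal. *)
Definition pendant_star (G : sgraph) (q : G) : {set G} :=
  q |: [set p | pendant p && adj q p].

Definition pendant_star_pairs (G : sgraph) : {set {set G}} :=
  [set e : {set G} | (#|e| == 2) &&
    [exists q : G, quasi_pendant q &&
      (e \subset [set p in pendant_star q | pendant p])]].

Section AddEdges.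
Variables (G : sgraph) (E : {set {set G}}).

Definition add_edges_adj : rel G :=
  fun x y => adj x y || (x != y) && ([set x; y] \in E).

Lemma add_edges_adj_sym : symmetric add_edges_adj.
Proof. by move=> x y; rewrite /add_edges_adj adj_sym eq_sym setUC. Qed.

Lemma add_edges_adj_irrefl : irreflexive add_edges_adj.
Proof. by move=> x; rewrite /add_edges_adj adj_irrefl eqxx. Qed.

Definition add_edges : sgraph := SGraph add_edges_adj_sym add_edges_adj_irrefl.

End AddEdges.

(* Main.v *)
Require Import Defs.
From HB Require Import structures.
From mathcomp Require Import all_boot all_order all_algebra.
From mathcomp Require Import reals complex polyrcf spectral sesquilinear.
From mathcomp Require Import ring lra zify.

(** Among the graphs considered, a minimiser [G] of the algebraic connectivity
    is compared with double brooms. Write [a] for the algebraic connectivity of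
    [G] and [f] for a Fiedler vector, an eigenvector for [a] of mean zero.

    The domination number enters only through the diameter: vertices at the
    distances 0, 3, 6, ... on a shortest path need different dominating
    vertices, so any two vertices are joined by a path with at most
    [3 * gamma] vertices ([path_in_few_vertices]). The tree [T_order] realises
    this bound, unless it is a path on all [n] vertices, and it has domination
    number [gamma] ([T_kld_domination]).

    Take a path from a maximum of [f] to a minimum and list the values of [f]
    on it, the spine, in decreasing order. For every threshold the edges that
    cross it carry a total flux of [a] times the sum of [f] above it, so the
    gap between two consecutive values is at most this quantity. The
    bound is weakest when all the vertices off the spine sit at the extreme
    values of [f], which is how the pendant vertices of a double broom behave.
    Hence the values on the spine yield a test vector on a double broom [B] with
    the same number of vertices, which shows that its algebraic
    connectivity is at most [a] ([spine_bound]). In case of equality, all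
    these estimates are equalities: the off-spine vertices do have
    extreme values, a single edge crosses each inner gap, and [G] is [B] up to
    edges between vertices attached to the same end ([spine_leveling]).

    It remains to see that [B] is balanced. If it has more pendant vertices at
    one end, a monotone Fiedler vector has the smaller amplitude at that end
    ([heavy_end_small]), and this vector and its mirror image span a plane on
    which the Rayleigh quotient of a better balanced broom is less than that of
    [B] ([balance_decreases]). So an unbalanced [B] would have a larger algebraic
    connectivity than [T_order], and [G] would not be a minimiser.

    When [gamma = 1], the comparison with a star gives [a <= 1]. A Fiedler vector
    then vanishes at a dominating vertex [v], and its maxima form a set that is
    closed under adjacency in the graph without [v], which is therefore
    disconnected ([dominating_cut_vertex]). *)

Set Implicit Arguments.
Unset Strict Implicit.
Unset Printing Implicit Defensive.

Import Order.TTheory GRing.Theory Num.Theory.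
Local Open Scope ring_scope.

(** * Eigenvalues of real symmetric matrices *)

Section SymmetricMatrices.
Variables (R : rcfType) (n : nat).
Local Notation toC := (real_complex R).
Local Open Scope sesquilinear_scope.

(** Both lists are sorted, so it is enough to compare multiplicities, and the
    multiplicity of [x] as a root counts the factors equal to ['X - x]. *)
Lemma sort_prod_eigenvalues (A : 'M[R]_n) (r : 'I_n -> R) :
  char_poly A = \prod_i ('X - (r i)%:P) ->
  eigenvalues A = sort <=%R [seq r i | i <- enum 'I_n].
Proof.
move=> chA; set s := [seq r i | i <- enum 'I_n].
have chs : char_poly A = \prod_(y <- s) ('X - y%:P).
  by rewrite chA big_map big_enum.
have ch0 : char_poly A != 0 by rewrite monic_neq0 ?char_poly_monic.
apply: (sorted_eq le_trans le_anti).
- rewrite /eigenvalues.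
  have : sorted <=%R (rootsR (char_poly A)).
    exact: (sub_sorted (@ltW _ R) (sorted_roots _ _ _)).
  elim: (rootsR _) => //= a t IHt; rewrite path_sortedE; last exact: le_trans.
  case/andP=> /allP leat st; move: (IHt st) => {}IHt.
  set q := flatten _ in IHt *.
  have allq : all (>= a) q.
    apply/allP => x /flattenP [u /mapP [y yt ->]].
    by rewrite mem_nseq => /andP [_ /eqP ->]; apply: leat.
  elim: (mup _ _) => //= m IHm; rewrite path_sortedE; last exact: le_trans.
  rewrite IHm andbT; apply/allP => x; rewrite mem_cat mem_nseq.
  by case/orP=> [/andP [_ /eqP ->] //|/(allP allq)].
- by apply: sort_sorted; apply: le_total.
rewrite perm_sym perm_sort perm_sym.
apply/allP => x _ /=; apply/eqP.
rewrite -(mu_prod_XsubC x s) -chs /eigenvalues count_flatten -map_comp sumnE big_map.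
have cnt y : (count_mem x \o (fun y => nseq (mup y (char_poly A)) y)) y
   = (mup x (char_poly A) * (y == x))%N.
  by rewrite /= count_nseq /=; case: eqP => [->|]; rewrite ?mul1n ?muln1 ?muln0.
under eq_bigr => y _ do rewrite cnt.
rewrite -big_distrr /=.
have [xr|xr] := boolP (x \in rootsR (char_poly A)).
  rewrite (bigD1_seq x) //=; last first.
    exact: (sorted_uniq lt_trans (@ltxx _ R) (sorted_roots _ _ _)).
  by rewrite eqxx big1 ?addn0 ?muln1 // => y /negbTE ->.
have : ~~ root (char_poly A) x.
  move: xr; have := roots_on_rootsR ch0 x; rewrite in_itv /= => ->.
  by [].
by move=> /mupNroot ->; rewrite mul0n.
Qed.

Local Notation "M %:CM" := (map_mx toC M) (at level 2, format "M %:CM").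

Lemma conj_realmx m k (M : 'M[R]_(m, k)) : (M%:CM)^t* = (M^T)%:CM.
Proof. by apply/matrixP => i j; rewrite !mxE; apply: conjc_real. Qed.

(** A real symmetric matrix is Hermitian over the complex extension [R[i]], so
    it is unitarily diagonalisable there with a real diagonal. Similar matrices
    have the same characteristic polynomial, which therefore splits over [R]. *)
Lemma symmetric_spectral (A : 'M[R]_n) : A^T = A ->
  exists (P : 'M[R[i]]_n) (r : 'rV[R]_n),
    [/\ P \is unitarymx, A%:CM = P^t* *m diag_mx (r%:CM) *m P
      & char_poly A = \prod_i ('X - (r 0 i)%:P)].
Proof.
move=> Asym; pose P := spectralmx A%:CM; pose d := spectral_diag A%:CM.
have herm : A%:CM \is hermsymmx.
  apply/is_hermitianmxP; rewrite expr0 scale1r.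
  by rewrite conj_realmx Asym.
have dreal := hermitian_spectral_diag_real herm.
have /orthomx_spectralP AE := hermitian_normalmx herm.
have PU : P \is unitarymx by apply: spectral_unitarymx.
pose r : 'rV[R]_n := \row_i complex.Re (d 0 i).
have dE : d = r%:CM.
  apply/rowP => i; rewrite !mxE RRe_real //.
  exact: (mxOverP dreal).
exists P, r; split=> //; first by rewrite -dE -invmx_unitary.
apply: (map_inj_poly (fmorph_inj toC)) => //.
rewrite map_char_poly AE -/P -/d dE.
rewrite rmorph_prod /=; under eq_bigr => i _ do rewrite map_polyXsubC.
have -> : \prod_(i < n) ('X - (toC (r 0 i))%:P) = char_poly (diag_mx r%:CM).
  rewrite char_poly_trig ?diag_mx_is_trig //.
  by apply: eq_bigr => i _; rewrite !mxE eqxx mulr1n.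
rewrite /char_poly /char_poly_mx !map_mxM /=.
have PV : map_mx polyC (invmx P) *m map_mx polyC P = 1%:M.
  by rewrite -map_mxM mulVmx ?map_mx1 // unitarymx_unit.
set Q := map_mx polyC (invmx P) in PV *; set Q' := map_mx polyC P in PV *.
rewrite -[X in \det (X - _) = _](_ : Q *m 'X%:M *m Q' = _); last first.
  by rewrite -mulmxA -scalar_mxC mulmxA PV mul1mx.
by rewrite -mulmxBl -mulmxBr !det_mulmx mulrAC -det_mulmx PV det1 mul1r.
Qed.

(** Picks the two entries of the diagonal that realise the two smallest
    eigenvalues, at distinct positions even when the eigenvalues coincide. *)
Lemma two_smallest (r : 'I_n -> R) : (1 < n)%N ->
  let e := sort <=%R [seq r i | i <- enum 'I_n] in
  exists i0 i1 : 'I_n, [/\ i0 != i1, r i0 <= e`_1, r i1 = e`_1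
    & forall i, i != i0 -> e`_1 <= r i].
Proof.
move=> n1 e.
pose t := sort (relpre r <=%R) (enum 'I_n).
have et : e = map r t by rewrite /e sort_map.
have st : size t = n by rewrite size_sort size_enum_ord.
have ut : uniq t by rewrite sort_uniq enum_uniq.
have mt i : i \in t by rewrite mem_sort mem_enum.
have so : sorted <=%R e by apply: sort_sorted; apply: le_total.
have le_e i j : (i <= j < n)%N -> e`_i <= e`_j.
  case/andP=> ij jn; apply: (sorted_leq_nth le_trans lexx) => //.
  - by rewrite inE et size_map st (leq_ltn_trans ij).
  - by rewrite inE et size_map st.
have i : 'I_n by exists 0%N; apply: ltn_trans n1.
have n0 : (0 < n)%N by apply: ltn_trans n1.
have eE j : (j < n)%N -> r (nth i t j) = e`_j.
  by move=> jn; rewrite et (nth_map i) ?st.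
exists (nth i t 0), (nth i t 1); split.
- by rewrite nth_uniq ?st.
- by rewrite eE //; apply: le_e.
- exact: eE.
move=> j; have ij : (index j t < n)%N by rewrite -[X in (_ < X)%N]st index_mem.
rewrite -(nth_index i (mt j)) nth_uniq ?st // -lt0n => j0.
by rewrite eE //; apply: le_e; rewrite j0.
Qed.

Local Notation ones := (const_mx 1 : 'cV[R]_n).

Lemma hermitian_form_diag (A : 'M[R]_n) (P : 'M[R[i]]_n) (r : 'rV[R]_n) (z : 'rV[R[i]]_n) :
  P \is unitarymx -> A%:CM = P^t* *m diag_mx (r%:CM) *m P ->
  ((z *m P) *m A%:CM *m (z *m P)^t*) 0 0 = \sum_i toC (r 0 i) * `|z 0 i| ^+ 2.
Proof.
move=> PU ->; rewrite !trmx_mul !map_mxM !mulmxA !mulmxtVK // mxE; apply: eq_bigr => i _.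
by rewrite mul_mx_diag !mxE normCK mulrAC mulrC.
Qed.

Lemma hermitian_norm_diag (P : 'M[R[i]]_n) (z : 'rV[R[i]]_n) :
  P \is unitarymx -> ((z *m P) *m (z *m P)^t*) 0 0 = \sum_i `|z 0 i| ^+ 2.
Proof.
move=> PU; rewrite !trmx_mul !map_mxM !mulmxA mulmxtVK // mxE; apply: eq_bigr => i _.
by rewrite !mxE normCK.
Qed.

Lemma toC_form (A : 'M[R]_n) (x : 'rV[R]_n) :
  toC ((x *m A *m x^T) 0 0) = (x%:CM *m A%:CM *m (x%:CM)^t*) 0 0.
Proof. by rewrite conj_realmx -!map_mxM [RHS]mxE. Qed.

Lemma toC_norm (x : 'rV[R]_n) :
  toC ((x *m x^T) 0 0) = (x%:CM *m (x%:CM)^t*) 0 0.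
Proof. by rewrite conj_realmx -!map_mxM [RHS]mxE. Qed.

(** If the second eigenvalue is positive, the kernel is a line, hence spanned
    by the all-ones vector; a vector orthogonal to it has no component on the
    first eigenvector, and all other eigenvalues are large enough. If the
    second eigenvalue is not positive, semidefiniteness suffices. *)
Lemma eigenvalue1_le_form (A : 'M[R]_n) (x : 'rV[R]_n) : (1 < n)%N ->
  A^T = A -> (forall y : 'rV_n, 0 <= (y *m A *m y^T) 0 0) ->
  A *m ones = 0 -> x *m ones = 0 ->
  (eigenvalues A)`_1 * (x *m x^T) 0 0 <= (x *m A *m x^T) 0 0.
Proof.
move=> n1 Asym Apsd A1 x1.
have [P [r [PU AE chA]]] := symmetric_spectral Asym.
rewrite (sort_prod_eigenvalues chA).
have [i0 [i1 [i01 r0 r1 rge]]] := two_smallest (r 0) n1.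
set e1 := (sort _ _)`_1 in r0 r1 rge *.
have [e1le|e1gt] := lerP e1 0.
  apply: le_trans (Apsd x); rewrite mulr_le0_ge0 // mxE.
  by apply: sumr_ge0 => i _; rewrite mxE -expr2 sqr_ge0.
pose y := x%:CM *m P^t*.
have xy : x%:CM = y *m P by rewrite mulmxKtV.
rewrite -lecR rmorphM /= toC_norm toC_form xy.
rewrite (hermitian_form_diag _ PU AE) (hermitian_norm_diag _ PU) mulr_sumr.
pose c := P *m (ones%:CM).
have Dc : diag_mx (r%:CM) *m c = 0.
  have : P *m (A *m ones)%:CM = 0 by rewrite A1 map_mx0 mulmx0.
  by rewrite map_mxM AE !mulmxA (unitarymxP PU) mul1mx -mulmxA.
have c0 i : i != i0 -> c i 0 = 0.
  move=> /rge ri; move/matrixP/(_ i 0): Dc; rewrite mul_diag_mx !mxE => /eqP.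
  rewrite mulf_eq0 fmorph_eq0 gt_eqF ?(lt_le_trans e1gt ri) //= => /eqP.
  exact.
have yc : y 0 i0 * c i0 0 = 0.
  have : (x *m ones)%:CM = 0 by rewrite x1 map_mx0.
  rewrite map_mxM xy -mulmxA -/c => /matrixP/(_ 0 0).
  rewrite [LHS]mxE [RHS]mxE (bigD1 i0) //=.
  by rewrite big1 ?addr0 // => i /c0 ->; rewrite mulr0.
have ci0 : c i0 0 != 0.
  apply/eqP => ci0; have : c = 0.
    apply/colP => i; rewrite [RHS]mxE; have [->//|] := eqVneq i i0.
    exact: c0.
  move/(congr1 (mulmx (P^t*))); rewrite mulmx0 /c mulmxA.
  have -> : P^t* *m P = 1%:M by apply: mulmx1C; apply/unitarymxP.
  rewrite mul1mx => /colP/(_ i0); rewrite !mxE => /eqP.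
  by rewrite fmorph_eq0 oner_eq0.
have y0 : y 0 i0 = 0 by move/eqP: yc; rewrite mulf_eq0 (negbTE ci0) orbF => /eqP.
apply: ler_sum => i _; have [->|ii0] := eqVneq i i0.
  by rewrite y0 normr0 expr0n !mulr0.
by rewrite ler_wpM2r ?exprn_ge0 // lecR rge.
Qed.

(** The cross terms cancel by symmetry, so a Hermitian Rayleigh quotient is
    controlled by those of the real and imaginary parts; this brings complex
    eigenvectors back to real ones. *)
Lemma hermitian_form_rect (A : 'M[R]_n) (a b : 'rV[R]_n) : A^T = A ->
  let u := a%:CM + 'i%C *: b%:CM in
  (u *m A%:CM *m u^t*) 0 0
    = toC ((a *m A *m a^T) 0 0 + (b *m A *m b^T) 0 0).
Proof.
move=> Asym u.
have -> : u^t* = a^T%:CM - 'i%C *: b^T%:CM.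
  apply/matrixP => i j; rewrite !mxE; apply: etrans (_ : conjc _ = _) => //.
  by simpc.
have ab : b *m A *m a^T = a *m A *m b^T.
  have -> : b *m A *m a^T = (a *m A *m b^T)^T by rewrite !trmx_mul Asym trmxK mulmxA.
  by rewrite [X in X^T]mx11_scalar tr_scalar_mx -mx11_scalar.
rewrite /u mulmxDl mulmxBr !mulmxDl -!scalemxAr -!scalemxAl -!map_mxM ab.
rewrite !mxE rmorphD /=; set p := toC _; set q := toC _; set t := toC _.
by have := sqr_i R; set I := 'i%C => I2; ring: I2.
Qed.

(** Two independent eigenvectors for the two smallest eigenvalues span a
    nonzero complex vector orthogonal to the all-ones vector; its real or its
    imaginary part does not exceed the second eigenvalue. Together with
    [eigenvalue1_le_form] this is the Courant-Fischer characterisation. *)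
Lemma eigenvalue1_attained (A : 'M[R]_n) : (1 < n)%N -> A^T = A ->
  (forall y : 'rV_n, 0 <= (y *m A *m y^T) 0 0) ->
  A *m ones = 0 ->
  exists x : 'rV[R]_n, [/\ x != 0, x *m ones = 0
   & (x *m A *m x^T) 0 0 <= (eigenvalues A)`_1 * (x *m x^T) 0 0].
Proof.
move=> n1 Asym Apsd A1.
have [P [r [PU AE chA]]] := symmetric_spectral Asym.
have [i0 [i1 [i01 r0 r1 _]]] := two_smallest (r 0) n1.
rewrite -(sort_prod_eigenvalues chA) in r0 r1.
set e1 := _`_1 in r0 r1 *.
have [s sE] : exists s, s = P *m (ones%:CM) by eexists.
have [z [z0 zs zi]] : exists z : 'rV[R[i]]_n,
    [/\ z != 0, z *m s = 0 & forall i, i != i0 -> i != i1 -> z 0 i = 0].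
  have d0 (i : 'I_n) (c : R[i]) : (c *: delta_mx 0 i : 'rV[R[i]]_n) *m s
      = (c * s i 0)%:M.
    by rewrite -scalemxAl -rowE [row _ _]mx11_scalar !mxE scale_scalar_mx.
  have [s0|s0] := eqVneq (s i0 0) 0.
    exists (1 *: delta_mx 0 i0); split.
    - by apply/eqP => /rowP/(_ i0)/eqP; rewrite !mxE !eqxx mulr1 oner_eq0.
    - by rewrite d0 s0 mulr0 raddf0.
    - by move=> i /negbTE i0F _; rewrite !mxE i0F andbF mulr0.
  exists (s i1 0 *: delta_mx 0 i0 - s i0 0 *: delta_mx 0 i1); split.
  - apply/eqP => /rowP/(_ i1)/eqP; rewrite !mxE !eqxx (eq_sym i1) (negbTE i01) /=.
    by rewrite mulr0 mulr1 sub0r oppr_eq0 (negbTE s0).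
  - by rewrite mulmxBl !d0 [s i1 0 * _]mulrC subrr.
  - by move=> i /negbTE i0F /negbTE i1F; rewrite !mxE i0F i1F andbF !mulr0 subr0.
pose u := z *m P.
pose a := u ^ (@complex.Re R); pose b := u ^ (@complex.Im R).
have uE : u = a%:CM + 'i *: b%:CM.
  by apply/rowP => i; rewrite !mxE; apply: complexE.
have u1 : u *m ones%:CM = 0 by rewrite /u -mulmxA -sE.
have su : \sum_k u 0 k = 0.
  move/matrixP/(_ 0 0): u1; rewrite [LHS]mxE [RHS]mxE; apply: etrans.
  by apply: eq_bigr => k _; rewrite [X in _ = _ * X]mxE [ones _ _]mxE rmorph1 mulr1.
have ab1 : a *m ones = 0 /\ b *m ones = 0.
  split; apply/matrixP => i j; rewrite !ord1 [LHS]mxE [RHS]mxE.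
    rewrite -[RHS](congr1 (@complex.Re R) su) raddf_sum.
    by apply: eq_bigr => k _; rewrite [a _ _]mxE [ones _ _]mxE mulr1.
  rewrite -[RHS](congr1 (@complex.Im R) su) raddf_sum.
  by apply: eq_bigr => k _; rewrite [b _ _]mxE [ones _ _]mxE mulr1.
case: ab1 => a1 b1.
have ab0 : a != 0 \/ b != 0.
  have [a0|] := eqVneq a 0; last by left.
  have [b0|] := eqVneq b 0; last by right.
  have : u *m P^t* = 0 by rewrite uE a0 b0 !map_mx0 scaler0 addr0 mul0mx.
  by rewrite /u mulmxtVK // => /eqP; rewrite (negbTE z0).
pose q (y : 'rV[R]_n) := (y *m A *m y^T) 0 0 - e1 * (y *m y^T) 0 0.
have q0 : q 0 = 0 by rewrite /q !mul0mx !mxE mulr0 subr0.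
have qab : q a + q b <= 0.
  have uP : (u *m A%:CM *m u^t*) 0 0 <= toC e1 * (u *m u^t*) 0 0.
    rewrite (hermitian_form_diag _ PU AE) (hermitian_norm_diag _ PU) mulr_sumr.
    apply: ler_sum => i _; have [->|ii0] := eqVneq i i0.
      by rewrite ler_wpM2r ?exprn_ge0 // lecR.
    have [->|ii1] := eqVneq i i1; first by rewrite r1.
    by rewrite zi // normr0 expr0n !mulr0.
  have := hermitian_form_rect a b Asym; rewrite /= -uE => uA.
  have := hermitian_form_rect a b (trmx1 _ _); rewrite /= -uE map_mx1 !mulmx1 => u1'.
  move: uP; rewrite uA u1' -rmorphM lecR /q mulrDr; lra.
have [qa|qa] := lerP (q a) 0; last first.
  exists b; split=> //; last by rewrite -subr_le0 -[_ - _]/(q b); lra.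
  apply/eqP => b0; move: qab; by rewrite b0 q0 addr0 leNgt qa.
have [qb|qb] := lerP (q b) 0; last first.
  exists a; split=> //; last by rewrite -subr_le0.
  apply/eqP => a0; move: qab; by rewrite a0 q0 add0r leNgt qb.
by case: ab0 => [a0|b0]; [exists a|exists b]; split=> //; rewrite -subr_le0.
Qed.
End SymmetricMatrices.

(** * The Laplacian operator and its Fiedler vectors *)

Section Laplacian.
Variables (R : rcfType) (G : sgraph).
Implicit Types x y : G -> R.

Definition lap x (u : G) : R := \sum_(v | adj u v) (x u - x v).

Definition dirichlet x y : R := \sum_u x u * lap y u.

(** Green's formula: the quadratic form of the Laplacian is the sum over the
    edges of the squared differences, each edge being met twice on the right. *)
Lemma dirichletE x y :
  dirichlet x y *+ 2 = \sum_u \sum_(v | adj u v) (x u - x v) * (y u - y v).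
Proof.
have E1 : dirichlet x y = \sum_u \sum_(v | adj u v) x u * (y u - y v).
  by apply: eq_bigr => u _; rewrite mulr_sumr.
have E2 : dirichlet x y = \sum_u \sum_(v | adj u v) - x v * (y u - y v).
  rewrite E1 (exchange_big_dep xpredT) //=; apply: eq_bigr => u _.
  rewrite (eq_bigl (adj u)) => [|v]; last by rewrite adj_sym.
  by apply: eq_bigr => v _; rewrite mulNr -mulrN opprB.
rewrite mulr2n {1}E1 E2 -big_split; apply: eq_bigr => u _ /=.
by rewrite -big_split; apply: eq_bigr => v _ /=; ring.
Qed.

Lemma dirichletC x y : dirichlet x y = dirichlet y x.
Proof.
apply: (@mulIr _ 2%:R); first by rewrite unitfE pnatr_eq0.
rewrite !mulr_natr !dirichletE; apply: eq_bigr => u _.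
by apply: eq_bigr => v _; rewrite mulrC.
Qed.

Lemma dirichlet_ge0 x : 0 <= dirichlet x x.
Proof.
rewrite -(pmulrn_lge0 _ (isT : (0 < 2)%N)) dirichletE.
by apply: sumr_ge0 => u _; apply: sumr_ge0 => v _; rewrite -expr2 sqr_ge0.
Qed.

Lemma lapD x y u : lap (fun v => x v + y v) u = lap x u + lap y u.
Proof. by rewrite -big_split; apply: eq_bigr => v _ /=; ring. Qed.

Lemma lapZ a x u : lap (fun v => a * x v) u = a * lap x u.
Proof. by rewrite mulr_sumr; apply: eq_bigr => v _ /=; ring. Qed.

Lemma lap_cst a u : lap (fun _ => a) u = 0.
Proof. by apply: big1 => v _; rewrite subrr. Qed.

Lemma dirichletDr x y z :
  dirichlet x (fun v => y v + z v) = dirichlet x y + dirichlet x z.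
Proof. by rewrite -big_split; apply: eq_bigr => v _; rewrite lapD mulrDr. Qed.

Lemma dirichletZr a x y : dirichlet x (fun v => a * y v) = a * dirichlet x y.
Proof. by rewrite mulr_sumr; apply: eq_bigr => v _; rewrite lapZ mulrCA. Qed.

Lemma dirichletDl x y z :
  dirichlet (fun v => y v + z v) x = dirichlet y x + dirichlet z x.
Proof. by rewrite dirichletC dirichletDr ![dirichlet x _]dirichletC. Qed.

Lemma dirichletZl a x y : dirichlet (fun v => a * y v) x = a * dirichlet y x.
Proof. by rewrite dirichletC dirichletZr dirichletC. Qed.

Lemma sum_lap x : \sum_u lap x u = 0.
Proof.
have := dirichletC (fun=> 1) x; rewrite /dirichlet.
under eq_bigr do rewrite mul1r.
by move=> ->; apply: big1 => u _; rewrite lap_cst mulr0.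
Qed.

Definition row_of_fun x : 'rV[R]_#|G| := \row_i x (enum_val i).

Lemma sum_enum_val (F : G -> R) : \sum_(i < #|G|) F (enum_val i) = \sum_u F u.
Proof. by rewrite -big_enum_val. Qed.

Lemma row_of_fun_onto (r : 'rV[R]_#|G|) : exists x, r = row_of_fun x.
Proof.
exists (fun u => r 0 (enum_rank u)).
by apply/rowP => i; rewrite mxE enum_valK.
Qed.

Lemma row_of_fun_sum x : row_of_fun x *m const_mx 1 = (\sum_u x u)%:M :> 'M_1.
Proof.
apply/matrixP => i j; rewrite !ord1 !mxE eqxx mulr1n -sum_enum_val.
by apply: eq_bigr => k _; rewrite !mxE mulr1.
Qed.

Lemma row_of_fun_dot x y :
  (row_of_fun x *m (row_of_fun y)^T) 0 0 = \sum_u x u * y u.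
Proof.
rewrite mxE -(sum_enum_val (fun u => x u * y u)).
by apply: eq_bigr => k _; rewrite !mxE.
Qed.

Lemma laplacian_sym : (laplacian R G)^T = laplacian R G.
Proof.
rewrite /laplacian /degree_mx linearB /= tr_diag_mx; congr (_ - _).
by apply/matrixP => i j; rewrite !mxE adj_sym.
Qed.

Lemma laplacian_mul x : laplacian R G *m (row_of_fun x)^T = (row_of_fun (lap x))^T.
Proof.
apply/colP => i; rewrite mulmxBl mul_diag_mx !mxE.
under eq_bigr do rewrite !mxE.
rewrite (sum_enum_val (fun v => (adj (enum_val i) v)%:R * x v)).
rewrite /lap sumrB; congr (_ - _).
  by rewrite sumr_const mulr_natl /degree cardsE.
by rewrite [RHS]big_mkcond; apply: eq_bigr => v _; case: ifP; rewrite ?mul1r ?mul0r.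
Qed.

Lemma row_of_fun_form x y :
  (row_of_fun x *m laplacian R G *m (row_of_fun y)^T) 0 0 = dirichlet x y.
Proof. by rewrite -mulmxA laplacian_mul row_of_fun_dot. Qed.

Lemma laplacian_psd (r : 'rV_#|G|) : 0 <= (r *m laplacian R G *m r^T) 0 0.
Proof.
by have [x ->] := row_of_fun_onto r; rewrite row_of_fun_form dirichlet_ge0.
Qed.

Lemma laplacian_ones : laplacian R G *m (const_mx 1 : 'cV_#|G|) = 0.
Proof.
have -> : const_mx 1 = (row_of_fun (fun=> 1))^T by apply/colP => i; rewrite !mxE.
rewrite laplacian_mul; apply/colP => i; rewrite !mxE; exact: lap_cst.
Qed.

Hypothesis G_gt1 : (1 < #|G|)%N.
Local Notation alpha := (algebraic_connectivity R G).

Lemma algebraic_connectivity_le x : \sum_u x u = 0 ->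
  alpha * (\sum_u x u ^+ 2) <= dirichlet x x.
Proof.
move=> x0; rewrite -row_of_fun_form; under eq_bigr do rewrite expr2.
rewrite -row_of_fun_dot; apply: eigenvalue1_le_form => //.
- exact: laplacian_sym.
- exact: laplacian_psd.
- exact: laplacian_ones.
by rewrite row_of_fun_sum x0 raddf0.
Qed.

(** First variation: perturbing [x] in the direction [r] of its own residual
    changes the energy excess to first order by the squared norm of [r], so a
    minimiser has zero residual. *)
Lemma dirichlet_minimizer_eigen x : \sum_u x u = 0 ->
  dirichlet x x <= alpha * (\sum_u x u ^+ 2) ->
  forall u, lap x u = alpha * x u.
Proof.
move=> x0 xmin.
pose r u := lap x u - alpha * x u.
have r0 : \sum_u r u = 0 by rewrite sumrB sum_lap -mulr_sumr x0 mulr0 subrr.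
pose s := \sum_u r u ^+ 2.
pose c := dirichlet r r - alpha * \sum_u r u ^+ 2.
have q t : 0 <= 2 * t * s + t ^+ 2 * c.
  have := @algebraic_connectivity_le (fun u => x u + t * r u).
  rewrite big_split /= x0 -mulr_sumr r0 mulr0 addr0 => /(_ erefl).
  rewrite dirichletDl !dirichletDr !dirichletZl !dirichletZr.
  have -> : \sum_u (x u + t * r u) ^+ 2 = \sum_u x u ^+ 2
     + 2 * t * \sum_u x u * r u + t ^+ 2 * \sum_u r u ^+ 2.
    by rewrite !mulr_sumr -!big_split; apply: eq_bigr => u _ /=; ring.
  have sE : s = dirichlet r x - alpha * \sum_u x u * r u.
    rewrite /s /dirichlet mulr_sumr -sumrB; apply: eq_bigr => u _.
    by rewrite /r; ring.
  rewrite [dirichlet x r]dirichletC /c sE.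
  set d1 := dirichlet x x in xmin *; set n1 := \sum_u x u ^+ 2 in xmin *.
  set d2 := dirichlet r x; set d3 := dirichlet r r.
  set n2 := \sum_u x u * r u; set n3 := \sum_u r u ^+ 2.
  move=> h; have : 0 <= d1 - alpha * n1 + (2 * t * (d2 - alpha * n2)
     + t ^+ 2 * (d3 - alpha * n3)).
    by rewrite -subr_ge0 in h; apply: le_trans h _; rewrite le_eqVlt; apply/orP; left; apply/eqP; ring.
  by move: xmin; lra.
have s0 : s = 0.
  have sge : 0 <= s by apply: sumr_ge0 => u _; rewrite sqr_ge0.
  apply/eqP; rewrite eq_le sge andbT leNgt; apply/negP => sgt.
  (* A step so small that the linear term dominates. *)
  pose t := - s / (`|c| + 1).
  have c1 : 0 < `|c| + 1 by rewrite ltr_wpDl.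
  have := q t; rewrite leNgt => /negP; apply.
  have -> : 2 * t * s + t ^+ 2 * c = (s ^+ 2 / (`|c| + 1)) * (c / (`|c| + 1) - 2).
    by rewrite /t; field; rewrite gt_eqF.
  rewrite pmulr_rlt0 ?divr_gt0 ?exprn_gt0 // subr_lt0 ltr_pdivrMr //.
  by have := ler_norm c; have := normr_ge0 c; lra.
move=> u; apply/eqP; rewrite -subr_eq0 -sqrf_eq0; apply/eqP.
by apply: (psumr_eq0P _ s0) => // v _; rewrite sqr_ge0.
Qed.

Lemma fiedler_vector : exists x : G -> R,
  [/\ exists u, x u != 0, \sum_u x u = 0 & forall u, lap x u = alpha * x u].
Proof.
have [r [r0 r1 rle]] := eigenvalue1_attained G_gt1 laplacian_sym laplacian_psd laplacian_ones.
have [x rx] := row_of_fun_onto r; exists x; rewrite rx in r0 r1 rle *.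
have x0 : \sum_u x u = 0.
  by move: r1; rewrite row_of_fun_sum => /matrixP/(_ 0 0); rewrite !mxE eqxx mulr1n.
split=> //.
  apply/existsP; apply: contraR r0 => /existsPn xu0.
  apply/eqP/rowP => i; rewrite !mxE; apply/eqP; move: (xu0 (enum_val i)).
  by rewrite negbK.
apply: dirichlet_minimizer_eigen => //.
move: rle; rewrite row_of_fun_form row_of_fun_dot.
by under eq_bigr do rewrite -expr2.
Qed.

Lemma dirichlet0_const x : connected G -> dirichlet x x = 0 ->
  forall u v, x u = x v.
Proof.
move=> Gc x0.
have adjE u v : adj u v -> x u = x v.
  move=> uv; have := dirichletE x x; rewrite x0 mul0rn => /esym E.
  have in0 w : 0 <= \sum_(z | adj w z) (x w - x z) * (x w - x z).
    by apply: sumr_ge0 => z _; rewrite -expr2 sqr_ge0.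
  have Eu : \sum_(z | adj u z) (x u - x z) * (x u - x z) = 0.
    exact: (psumr_eq0P (fun w _ => in0 w) E).
  have in0' z : adj u z -> 0 <= (x u - x z) * (x u - x z).
    by move=> _; rewrite -expr2 sqr_ge0.
  have /eqP := psumr_eq0P in0' Eu uv.
  by rewrite mulf_eq0 orbb subr_eq0 => /eqP.
move=> u v; have /connectP [p pp ->] := forallP (forallP Gc u) v.
elim: p u pp => //= w p IHp u /andP [uw /IHp <-]; exact: adjE.
Qed.

Lemma algebraic_connectivity_gt0 : connected G -> 0 < alpha.
Proof.
move=> Gc; have [x [[u xu] xs xl]] := fiedler_vector.
have dE : dirichlet x x = alpha * \sum_u x u ^+ 2.
  by rewrite mulr_sumr; apply: eq_bigr => v _; rewrite xl; ring.
have npos : 0 < \sum_u x u ^+ 2.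
  rewrite (bigD1 u) //= ltr_pwDl ?sumr_ge0 // => [|v _]; last exact: sqr_ge0.
  by rewrite lt0r sqrf_eq0 xu sqr_ge0.
have dge := dirichlet_ge0 x.
rewrite lt0r; apply/andP; split; last by move: dge; rewrite dE pmulr_lge0.
apply/eqP => a0; move: dE; rewrite a0 mul0r => /(dirichlet0_const Gc) xc.
have : \sum_v x v = x u *+ #|G|.
  by rewrite -sumr_const; apply: eq_bigr => v _; apply: xc.
rewrite xs => /esym/eqP; rewrite mulrn_eq0 (negbTE xu) orbF => /eqP G0.
by move: G_gt1; rewrite G0.
Qed.

End Laplacian.

(** * Graphs arranged in levels *)

Definition level_size (k l p i : nat) : nat :=
  if i == 0%N then k else if i == p then l else 1%N.

Definition consecutive (i j : nat) : bool := (i.+1 == j) || (j.+1 == i).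

(** The levels [0] and [p] have [k] and [l] vertices and every level between
    them has exactly one. Distinct levels are joined as in a double broom,
    while edges inside a level are left free; they can only occur in the two
    extreme levels. *)
Record leveling (G : sgraph) (k l p : nat) (ell : G -> nat) : Prop := Leveling {
  level_le : forall v, (ell v <= p)%N;
  level_card : forall i, (i <= p)%N ->
    #|[set v | ell v == i]| = level_size k l p i;
  level_adj : forall u v, ell u != ell v ->
    adj u v = consecutive (ell u) (ell v)
}.

(** Without edges inside the levels, the graph is the double broom made of a
    path on [p - 1] vertices with [k] and [l] pendant vertices at its ends. *)
Definition broom_leveling (G : sgraph) (k l p : nat) (ell : G -> nat) : Prop :=
  leveling k l p ell /\ forall u v, ell u = ell v -> ~~ adj u v.

Lemma leveling_rev (G : sgraph) k l p (ell : G -> nat) : (0 < p)%N ->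
  leveling k l p ell -> leveling l k p (fun v => (p - ell v)%N).
Proof.
move=> p0 [le_p cardE adjE]; split.
- by move=> v; rewrite leq_subr.
- move=> i ip; have -> : [set v | (p - ell v)%N == i] = [set v | ell v == (p - i)%N].
    by apply/setP => v; rewrite !inE; have := le_p v; lia.
  rewrite cardE ?leq_subr // /level_size.
  by case: (i =P 0%N) => ?; case: (i =P p) => ?; case: ((p - i)%N =P 0%N) => ?;
     case: ((p - i)%N =P p) => ?; lia.
move=> u v uv; have := le_p u; have := le_p v => vp up.
by rewrite adjE; [rewrite /consecutive; lia | lia].
Qed.

Lemma broom_leveling_rev (G : sgraph) k l p (ell : G -> nat) : (0 < p)%N ->
  broom_leveling k l p ell -> broom_leveling l k p (fun v => (p - ell v)%N).
Proof.
move=> p0 [lv nadj]; split; first exact: leveling_rev.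
by move=> u v uv; apply: nadj; have := level_le lv u; have := level_le lv v; lia.
Qed.

Lemma sum_level (R : nzRingType) (G : sgraph) k l p (ell : G -> nat) (F : nat -> R) :
  leveling k l p ell ->
  \sum_v F (ell v) = \sum_(i < p.+1) (level_size k l p i)%:R * F i.
Proof.
move=> lv.
pose h v : 'I_p.+1 := inord (ell v).
have hE v : h v = ell v :> nat by rewrite inordK // ltnS (level_le lv).
rewrite (partition_big h xpredT) //=; apply: eq_bigr => i _.
rewrite (eq_bigr (fun=> F i)) => [|v /eqP <-]; last by rewrite hE.
rewrite mulr_natl -(level_card lv (ltn_ord i : (i <= p)%N)) -sumr_const.
by apply: eq_bigl => v; rewrite inE -val_eqE /= hE.
Qed.

Section LeveledSums.
Variables (R : rcfType) (G : sgraph) (k l p : nat) (ell : G -> nat).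
Hypothesis lv : leveling k l p ell.
Local Notation w i := ((level_size k l p i)%:R : R).

Lemma sum_consecutive (F : nat -> nat -> R) :
  \sum_(i < p.+1) \sum_(j < p.+1) (i.+1 == j)%:R * F i j
   = \sum_(i < p) F i i.+1.
Proof.
rewrite big_ord_recr /= [X in _ + X]big1 ?addr0 => [|j _]; last first.
  by rewrite eqn_leq [(p < j)%N]ltnNge -ltnS ltn_ord mul0r.
apply: eq_bigr => i _; have ip : (i.+1 < p.+1)%N by rewrite ltnS.
rewrite (bigD1 (Ordinal ip)) //= eqxx mul1r big1 ?addr0 // => j.
by rewrite -val_eqE /= eq_sym => /negbTE ->; rewrite mul0r.
Qed.

Hypothesis broomG : forall u v, ell u = ell v -> ~~ adj u v.

Lemma level_dirichlet (x y : nat -> R) :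
  dirichlet (x \o ell) (y \o ell)
  = \sum_(i < p) w i * w i.+1 * ((x i - x i.+1) * (y i - y i.+1)).
Proof.
have lapE u : lap (y \o ell) u
   = \sum_(j < p.+1) w j * ((consecutive (ell u) j)%:R * (y (ell u) - y j)).
  rewrite -(sum_level (fun j => (consecutive (ell u) j)%:R * (y (ell u) - y j)) lv).
  rewrite /lap big_mkcond /=; apply: eq_bigr => v _.
  have [uv|uv] := eqVneq (ell u) (ell v).
    by rewrite (negbTE (broomG uv)) uv subrr mulr0.
  by rewrite (level_adj lv uv); case: consecutive; rewrite ?mul1r ?mul0r.
rewrite /dirichlet; under eq_bigr => u _ do rewrite lapE.
rewrite (sum_level (fun i => x i * \sum_(j < p.+1) w j * ((consecutive i j)%:R * (y i - y j))) lv).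
have split_sum : \sum_(i < p.+1) w i * (x i * \sum_(j < p.+1) w j * ((consecutive i j)%:R * (y i - y j)))
  = \sum_(i < p.+1) \sum_(j < p.+1) (i.+1 == j)%:R * (w i * w j * (x i * (y i - y j)))
  + \sum_(i < p.+1) \sum_(j < p.+1) (j.+1 == i)%:R * (w i * w j * (x i * (y i - y j))).
  rewrite -big_split; apply: eq_bigr => i _; rewrite -big_split !mulr_sumr /=.
  apply: eq_bigr => j _; rewrite /consecutive.
  have -> : (((i.+1 == j) || (j.+1 == i))%:R : R) = (i.+1 == j)%:R + (j.+1 == i)%:R.
    case: (i.+1 =P j :> nat) => [<-|_]; rewrite ?add0r //=.
    by rewrite gtn_eqF ?addr0.
  by ring.
rewrite split_sum [X in _ + X]exchange_big -big_split /=.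
under eq_bigr => i _ do rewrite -big_split /=.
rewrite -(sum_consecutive (fun i j => w i * w j * ((x i - x j) * (y i - y j)))).
by apply: eq_bigr => i _; apply: eq_bigr => j _; ring.
Qed.

(** Testing the eigenvector equation against the indicator function of the
    levels up to [i] leaves only the edges between the levels [i] and [i.+1]. *)
Lemma level_flow (y : nat -> R) a :
  (forall u, lap (y \o ell) u = a * y (ell u)) ->
  forall i, (i < p)%N ->
  w i * w i.+1 * (y i - y i.+1) = a * \sum_(j < i.+1) w j * y j.
Proof.
move=> eig i ip.
have := level_dirichlet (fun j => (j <= i)%N%:R) y.
rewrite (bigD1 (Ordinal ip)) //= leqnn ltnn subr0 mul1r big1 ?addr0 => [<-|j ji].
  rewrite /dirichlet (eq_bigr (fun u => (ell u <= i)%N%:R * (a * y (ell u)))) => [|u _]; last first.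
    by rewrite -eig.
  rewrite (sum_level (fun j => (j <= i)%N%:R * (a * y j)) lv) mulr_sumr.
  rewrite [RHS](big_ord_widen p.+1 (fun j => a * (w j * y j))) ?ltnS 1?ltnW //.
  rewrite [RHS]big_mkcond; apply: eq_bigr => j _; rewrite ltnS.
  by case: ifP => _; rewrite ?mul1r ?mul0r ?mulr0 // mulrCA.
have -> : (j < i)%N = (j <= i)%N.
  by rewrite [RHS]leq_eqVlt; move: ji; rewrite -val_eqE /= => /negbTE ->.
by rewrite subrr mul0r mulr0.
Qed.

(** Summation by parts. *)
Lemma abel_level (z : nat -> R) q :
  \sum_(i < q) (z i - z i.+1) * (\sum_(j < i.+1) w j * z j)
  = \sum_(i < q.+1) w i * z i ^+ 2 - z q * \sum_(i < q.+1) w i * z i.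
Proof.
elim: q => [|q IHq]; first by rewrite big_ord0 !big_ord1; ring.
rewrite big_ord_recr IHq /= [\sum_(i < q.+2) w i * z i ^+ 2]big_ord_recr.
rewrite [\sum_(i < q.+2) w i * z i]big_ord_recr /=; ring.
Qed.

(** A Collatz-Wielandt bound for the edge form of the Laplacian: for a
    nonincreasing sequence, it is enough that the flux through each edge level
    is at most [a] times the mass above it, since the energy and the squared
    norm are the pairings of the drops with these two quantities. *)
Lemma level_rayleigh (z : nat -> R) a :
  \sum_(i < p.+1) w i * z i = 0 ->
  (forall i, (i < p)%N -> z i.+1 <= z i) ->
  (forall i, (i < p)%N ->
     w i * w i.+1 * (z i - z i.+1) <= a * \sum_(j < i.+1) w j * z j) ->
  dirichlet (z \o ell) (z \o ell) <= a * \sum_v z (ell v) ^+ 2.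
Proof.
move=> z0 zdec zflow.
rewrite level_dirichlet (sum_level (fun i => z i ^+ 2) lv).
have := abel_level z p; rewrite z0 mulr0 subr0 => <-.
rewrite mulr_sumr; apply: ler_sum => i _.
rewrite mulrA mulrC [leRHS]mulrCA ler_wpM2l ?subr_ge0 ?zdec ?zflow //.
Qed.

End LeveledSums.

Section BroomLevels.
Variables (k l d : nat).
Hypothesis d_gt1 : (1 < d)%N.

Definition broom_depth : nat := (d.-1 + (0 < k) + (0 < l))%N.

(** The levels of [T_kld k l d] when [k] or [l] may vanish: an end of the path
    without pendant vertices is itself the only vertex of an extreme level. *)
Definition broom_level (v : T_kld k l d) : nat :=
  match v with
  | inl i => (i + (0 < k))%N
  | inr (inl _) => 0%N
  | inr (inr _) => broom_depth
  end.

Lemma T_kld_leveling :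
  broom_leveling (maxn k 1) (maxn l 1) broom_depth broom_level.
Proof.
have k0 (i : 'I_k) : (0 < k)%N by apply: leq_ltn_trans (ltn_ord i).
have l0 (i : 'I_l) : (0 < l)%N by apply: leq_ltn_trans (ltn_ord i).
split; first split.
- case=> [i|[i|i]] //=; rewrite /broom_depth; have := ltn_ord i; lia.
- move=> i ip; rewrite -sum1_card.
  rewrite (eq_bigl (fun v => broom_level v == i)) => [|v]; last by rewrite inE.
  rewrite big_mkcond !big_sumType /=.
  rewrite !sum_nat_const !card_ord.
  have -> : (\sum_(j < d) (if j + (0 < k) == i then 1 else 0) =
     (((0 < k) <= i) && (i < d + (0 < k))))%N.
    case: (leqP (0 < k)%N i) => ki /=; last first.
      by apply: big1 => j _; case: eqP => // ?; lia.
    case: (ltnP i (d + (0 < k))) => id /=; last first.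
      by apply: big1 => j _; case: eqP => // ?; have := ltn_ord j; lia.
    have id' : (i - (0 < k) < d)%N by lia.
    rewrite (bigD1 (Ordinal id')) //= subnK // eqxx big1 // => j.
    by rewrite -val_eqE /= => /eqP ne; case: eqP => // ?; lia.
  rewrite /level_size /broom_depth in ip *.
  rewrite (eq_sym _ i) (eq_sym _ i) /=.
  case: (ltnP 0 k) ip => k1; case: (ltnP 0 l) => l1 ip;
  case: (i =P 0%N) => i0; case: (i =P (d.-1 + _ + _)%N) => i1;
  rewrite ?muln0 ?muln1 ?addn0 /=; lia.
- move=> [i|[i|i]] [j|[j|j]] //=; rewrite /consecutive /broom_depth;
  have := ltn_ord i; have := ltn_ord j; try (have := k0 j); try (have := k0 i);
  try (have := l0 j); try (have := l0 i); lia.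
move=> [i|[i|i]] [j|[j|j]] //=; rewrite /broom_depth;
  have := ltn_ord i; have := ltn_ord j; try (have := k0 j); try (have := k0 i);
  try (have := l0 j); try (have := l0 i); lia.
Qed.

End BroomLevels.

(** * A test sequence on a double broom *)

Lemma broom_card (G : sgraph) k l p (ell : G -> nat) : (0 < p)%N ->
  leveling k l p ell -> #|G| = (k + l + p.-1)%N.
Proof.
move=> p0 lv; have := sum_level (fun=> 1 : int) lv.
rewrite sumr_const; under eq_bigr do rewrite mulr1.
case: p p0 lv => // q _ lv; rewrite big_ord_recl big_ord_recr /=.
rewrite (eq_bigr (fun=> 1)) => [|i _]; last first.
  by rewrite /level_size /= eqSS (ltn_eqF (ltn_ord i)).
rewrite sumr_const card_ord /level_size /= /bump /= add1n eqxx.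
by rewrite -!natrD [(q + l)%N]addnC addnA => /eqP; rewrite eqr_nat => /eqP <-.
Qed.

Section TestSequence.
Variables (R : rcfType) (B : sgraph) (k l p : nat) (ell : B -> nat).
Hypothesis brB : broom_leveling k l p ell.
Hypotheses (k_gt0 : (0 < k)%N) (l_gt0 : (0 < l)%N) (p_gt1 : (1 < p)%N).
Local Notation w i := ((level_size k l p i)%:R : R).
Variables (Y : nat -> R) (a : R).
Hypotheses (a_gt0 : 0 < a) (a_lt1 : a < 1).
Hypothesis Ydec : forall i, (i < p)%N -> Y i.+1 <= Y i.
Hypothesis Yp_lt0 : Y p < 0.
Hypothesis Yfirst : Y 0%N - Y 1%N <= a * Y 0%N.
Hypothesis Yflow : forall i, (0 < i < p)%N ->
  w i * w i.+1 * (Y i - Y i.+1) <= a * - \sum_(i.+1 <= j < p.+1) w j * Y j.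
Hypothesis Ytot : 0 <= \sum_(j < p.+1) w j * Y j.

(** The sequence [Y] is turned into a test sequence [Z] on the broom. Its mean
    need not vanish, and plain centring could break the flux condition at the
    pendant vertices of level [0]. Therefore the value there is first lowered to
    [X], either until the mean is zero, or, if this would go below [Y 1], to
    [Y 1], where these edges carry no flux; all the other flux conditions
    survive centring because the mean is nonnegative. Then [level_rayleigh]
    applies. In the equality case [Z] is an eigenvector, which rules out the
    second alternative and forces [X = Y 0]. *)
Lemma test_sequence :
  algebraic_connectivity R B <= a /\
  (a <= algebraic_connectivity R B ->
     \sum_(j < p.+1) w j * Y j = 0 /\
     forall i, (i < p)%N ->
       w i * w i.+1 * (Y i - Y i.+1) = a * \sum_(j < i.+1) w j * Y j).
Proof.
have [lv nadj] := brB.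
have p_gt0 : (0 < p)%N by apply: ltnW.
have w1 : w 1%N = 1 by rewrite /level_size /= ltn_eqF.
have w_gt0 i : 0 < w i by rewrite ltr0n /level_size; case: eqP => // _; case: eqP.
have w0 : w 0%N = k%:R by [].
have B1 : (1 < #|B|)%N by rewrite (broom_card p_gt0 lv); lia.
pose C : R := \sum_(j < p) w j.+1 * Y j.+1.
pose X : R := Num.max (Y 1%N) (- C / k%:R).
pose N : R := \sum_(j < p.+1) w j.
pose m : R := (k%:R * X + C) / N.
pose X' i := if i == 0%N then X else Y i.
pose Z i := X' i - m.
have kR : (0 : R) < k%:R by rewrite ltr0n.
have N_gt0 : 0 < N.
  rewrite /N big_ord_recl ltr_pwDl //; apply: sumr_ge0 => i _; exact: ltW.
have totE : \sum_(j < p.+1) w j * Y j = k%:R * Y 0%N + C by rewrite big_ord_recl.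
have XY0 : X <= Y 0%N.
  rewrite ge_max Ydec //= ler_pdivrMr //; move: Ytot; rewrite totE; lra.
have Y1X : Y 1%N <= X by rewrite le_max lexx.
have CX : 0 <= k%:R * X + C.
  have : - C / k%:R <= X by rewrite le_max lexx orbT.
  by rewrite ler_pdivrMr //; lra.
have m_ge0 : 0 <= m by rewrite divr_ge0 // ltW.
have mN : N * m = k%:R * X + C by rewrite /m mulrC divfK // gt_eqF.
have Zsum : \sum_(j < p.+1) w j * Z j = 0.
  rewrite (eq_bigr (fun j : 'I_p.+1 => w j * X' j - w j * m)) => [|j _]; last by rewrite mulrBr.
  rewrite sumrB -mulr_suml -/N big_ord_recl /= -/C.
  by rewrite mN subrr.
have Zdec i : (i < p)%N -> Z i.+1 <= Z i.
  move=> ip; rewrite lerB // /X' /=; case: i ip => //= i ip; exact: Ydec.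
have Z0_max i : (i <= p)%N -> Z i <= Z 0%N.
  by elim: i => // i IHi ip; apply: le_trans (Zdec _ ip) (IHi (ltnW ip)).
have Zp : Z p < 0.
  have X'p : X' p = Y p by rewrite /X' -(prednK p_gt0).
  by rewrite /Z X'p subr_lt0 (lt_le_trans Yp_lt0).
have Z0_gt0 : 0 < Z 0%N.
  rewrite ltNge; apply/negP => Z0; suff : \sum_(j < p.+1) w j * Z j < 0.
    by rewrite Zsum ltxx.
  rewrite big_ord_recr /=; apply: ltr_wnDl; last by rewrite pmulr_rlt0.
  apply: sumr_le0 => i _; rewrite pmulr_rle0 //; apply: le_trans Z0.
  by apply: Z0_max; apply: ltnW.
have tailE i : (i < p)%N ->
    \sum_(j < i.+1) w j * Z j = - \sum_(i.+1 <= j < p.+1) w j * Z j.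
  move=> ip; apply/eqP; rewrite -addr_eq0; apply/eqP; rewrite -[RHS]Zsum.
  rewrite -(big_mkord xpredT (fun j => w j * Z j)) -[RHS](big_mkord xpredT (fun j => w j * Z j)).
  by rewrite [RHS](big_cat_nat (n := i.+1)) // ltnW.
have tailZ i : (i < p)%N ->
    - \sum_(i.+1 <= j < p.+1) w j * Y j <= \sum_(j < i.+1) w j * Z j.
  move=> ip; rewrite tailE // lerN2; apply: ler_sum_nat => j /andP [ij _].
  rewrite ler_pM2l // /Z /X' gtn_eqF ?(leq_trans _ ij) //; lra.
have mX : X = Y 1%N \/ m = 0.
  rewrite /m /X; case: (leP (Y 1%N) (- C / k%:R)) => _; [right|by left].
  by rewrite [k%:R * _]mulrC divfK ?gt_eqF // addNr mul0r.
have Z0E : Z 0%N = X - m by [].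
have Z1E : Z 1%N = Y 1%N - m by [].
have Zflow i : (i < p)%N ->
    w i * w i.+1 * (Z i - Z i.+1) <= a * \sum_(j < i.+1) w j * Z j.
  case: i => [|i] ip.
    rewrite big_ord1 -mulrA [leRHS]mulrCA ler_pM2l // Z0E Z1E.
    rewrite w1 mul1r; case: mX => [XY|->]; last first.
      have : (1 - a) * X <= (1 - a) * Y 0%N by rewrite ler_pM2l // subr_gt0.
      by move: Yfirst; lra.
    by rewrite {1}XY subrr -Z0E mulr_ge0 // ltW.
  apply: le_trans (_ : a * - \sum_(i.+2 <= j < p.+1) w j * Y j <= _).
    have := Yflow (i := i.+1); rewrite ltnS /= => /(_ ip).
    by rewrite /Z /X' /=; apply: le_trans; rewrite le_eqVlt; apply/orP; left; apply/eqP; ring.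
  by rewrite ler_pM2l // tailZ.
have Bray := level_rayleigh brB.1 brB.2 Zsum Zdec Zflow.
have ZB0 : \sum_v Z (ell v) = 0 by rewrite (sum_level Z lv).
have ZB_gt0 : 0 < \sum_v Z (ell v) ^+ 2.
  rewrite (sum_level (fun i => Z i ^+ 2) lv) big_ord_recl ltr_pwDl //.
    by rewrite pmulr_rgt0 // exprn_gt0.
  by apply: sumr_ge0 => i _; rewrite pmulr_rge0 // sqr_ge0.
have Ble := algebraic_connectivity_le B1 ZB0.
split; first by move: (le_trans Ble Bray); rewrite ler_pM2r.
move=> aB; have aE : algebraic_connectivity R B = a.
  by apply/eqP; rewrite eq_le aB andbT; move: (le_trans Ble Bray); rewrite ler_pM2r.
have Beig := dirichlet_minimizer_eigen B1 ZB0; rewrite aE in Beig.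
have flow := level_flow lv nadj (Beig Bray).
have := flow 0%N p_gt0; rewrite big_ord1 -mulrA [RHS]mulrCA => /(mulfI (lt0r_neq0 (w_gt0 0%N))).
rewrite w1 mul1r => flow0.
have m0 : m = 0.
  case: mX => // XY; exfalso; move: flow0; rewrite Z0E Z1E XY subrr => /esym/eqP.
  by rewrite mulf_eq0 gt_eqF //= -XY -Z0E gt_eqF.
have XE : X = Y 0%N.
  apply/eqP; rewrite eq_le XY0 /=.
  have : (1 - a) * Y 0%N <= (1 - a) * X by move: flow0 Yfirst; rewrite Z0E Z1E m0; lra.
  by rewrite ler_pM2l // subr_gt0.
have ZE i : Z i = Y i by rewrite /Z /X' m0 subr0; case: eqP => // ->.
split; first by rewrite -[RHS]Zsum; apply: eq_bigr => j _; rewrite ZE.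
move=> i ip; have := flow i ip; rewrite !ZE => ->.
by congr (a * _); apply: eq_bigr => j _; rewrite ZE.
Qed.
End TestSequence.

(** * The spine of a Fiedler vector *)

Section Flux.
Variables (R : rcfType) (G : sgraph) (f : G -> R).

Lemma sum_lap_cut (A : pred G) : \sum_(u | A u) lap f u
  = \sum_(u | A u) \sum_(v | adj u v && ~~ A v) (f u - f v).
Proof.
rewrite /lap; under eq_bigr => u _ do rewrite (bigID A) /=.
rewrite big_split /= [X in X + _](_ : _ = 0) ?add0r //.
set S := LHS; suff /eqP : S = - S.
  by rewrite -addr_eq0 -mulr2n mulrn_eq0 => /eqP.
rewrite {1}/S (exchange_big_dep A) /= => [|u v _ /andP [] //].
rewrite /S -sumrN; apply: eq_bigr => u Au; rewrite -sumrN.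
rewrite (eq_bigl (fun v => adj u v && A v)) => [|v]; last first.
  by rewrite Au andbT adj_sym andbC.
by apply: eq_bigr => v _; rewrite opprB.
Qed.

(** All the edges that leave an upper level set carry a nonnegative flux, so one of
    them carries at most the total. *)
Lemma edge_le_flux (A : pred G) x y :
  (forall u v, A u -> ~~ A v -> f v <= f u) ->
  A x -> ~~ A y -> adj x y -> f x - f y <= \sum_(u | A u) lap f u.
Proof.
move=> Amono Ax Ay xy; rewrite sum_lap_cut (bigD1 x) //= (bigD1 y) ?xy //=.
rewrite -addrA lerDl addr_ge0 //.
  by apply: sumr_ge0 => v /andP [/andP [_ Av] _]; rewrite subr_ge0 Amono.
apply: sumr_ge0 => u /andP [Au _]; apply: sumr_ge0 => v /andP [_ Av].
by rewrite subr_ge0 Amono.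
Qed.

End Flux.

(** A set [s] of vertices, listed by decreasing value of [f], through which a
    path from a maximum [u0] to a minimum [w0] of [f] runs. Such a path is only
    used through the edge by which it leaves a set containing [u0] but not [w0],
    which is what [spine_cross] keeps of it. The other vertices are split into
    [U] and [D] by the sign of [f]; on either side the value zero is allowed so
    that the notion is preserved by [f |-> - f]. *)
Record spine (R : rcfType) (G : sgraph) (f : G -> R) (s : seq G) (u0 w0 : G)
    (U D : {set G}) : Prop := Spine {
  spine_uniq : uniq s;
  spine_sorted : sorted (fun x y => f y <= f x) s;
  spine_top : u0 \in s;
  spine_max : forall v, f v <= f u0;
  spine_bot : w0 \in s;
  spine_min : forall v, f w0 <= f v;
  spine_cross : forall A : pred G, A u0 -> ~~ A w0 ->
    exists x y, [/\ x \in s, y \in s, adj x y, A x & ~~ A y];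
  spine_cover : forall v, ((v \in s) + (v \in U) + (v \in D))%N = 1%N;
  spine_U : forall v, v \in U -> 0 <= f v;
  spine_D : forall v, v \in D -> f v <= 0
}.

Lemma spine_opp (R : rcfType) (G : sgraph) (f : G -> R) s u0 w0 U D :
  spine f s u0 w0 U D -> spine (fun v => - f v) (rev s) w0 u0 D U.
Proof.
case=> us ss u0s fu0 w0s fw0 cross cov fU fD; split.
- by rewrite rev_uniq.
- rewrite rev_sorted; apply: sub_sorted ss => x y; by rewrite lerN2.
- by rewrite mem_rev.
- by move=> v; rewrite lerN2.
- by rewrite mem_rev.
- by move=> v; rewrite lerN2.
- move=> A Aw0 Au0; have [|x [y [xs ys xy Ax Ay]]] := cross (predC A) Au0.
    by rewrite /= negbK.
  exists y, x; rewrite !mem_rev adj_sym; split=> //; first by rewrite /= negbK in Ay.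
- by move=> v; rewrite mem_rev -addnA [((v \in D) + _)%N]addnC addnA.
- by move=> v /fD; rewrite oppr_ge0.
- by move=> v /fU; rewrite oppr_le0.
Qed.

Section Spine.
Variables (R : rcfType) (G : sgraph) (f : G -> R) (a : R).
Variables (s : seq G) (u0 w0 : G) (U D : {set G}) (p : nat).
Hypothesis sp : spine f s u0 w0 U D.
Hypotheses (sz : size s = p.+1) (p_gt1 : (1 < p)%N).
Hypotheses (a_gt0 : 0 < a) (a_lt1 : a < 1).
Hypothesis feig : forall u, lap f u = a * f u.
Hypothesis fsum : \sum_u f u = 0.

Local Notation Y i := (f (nth u0 s i)).
Local Notation k := (#|U|.+1).
Local Notation l := (#|D|.+1).
Local Notation w i := ((level_size k l p i)%:R : R).

Lemma spine_sum (F : G -> R) : \sum_v F v =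
  \sum_(j < p.+1) F (nth u0 s j) + \sum_(v in U) F v + \sum_(v in D) F v.
Proof.
have -> : \sum_(j < p.+1) F (nth u0 s j) = \sum_(v in s) F v.
  rewrite -(big_mkord xpredT (fun j => F (nth u0 s j))) -sz -(big_nth u0 xpredT F).
  by rewrite big_uniq ?(spine_uniq sp).
rewrite [\sum_(v in s) _]big_mkcond [\sum_(v in U) _]big_mkcond [\sum_(v in D) _]big_mkcond.
rewrite -!big_split; apply: eq_bigr => v _ /=; have := spine_cover sp v.
by case: (v \in s); case: (v \in U); case: (v \in D) => //= _; rewrite ?addr0 ?add0r.
Qed.

Lemma spine_dec i j : (i <= j)%N -> (j <= p)%N -> Y j <= Y i.
Proof.
move=> ij jp; have tr : transitive (fun x y : G => f y <= f x).
  by move=> x y z yx xz; apply: le_trans xz yx.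
have re : reflexive (fun x y : G => f y <= f x) by move=> x /=.
apply: (sorted_leq_nth tr re u0 (spine_sorted sp)) => //; rewrite inE sz ltnS //.
exact: leq_trans jp.
Qed.

Lemma spine_nth x : x \in s -> exists2 i, (i <= p)%N & x = nth u0 s i.
Proof.
by move=> xs; exists (index x s); [rewrite -ltnS -sz index_mem | rewrite nth_index].
Qed.

Lemma spine_Y0 : Y 0%N = f u0.
Proof.
apply/eqP; rewrite eq_le (spine_max sp) /=.
have [i ip {1}->] := spine_nth (spine_top sp); exact: spine_dec.
Qed.

Lemma spine_Yp : Y p = f w0.
Proof.
apply/eqP; rewrite eq_le (spine_min sp) andbT.
have [i ip ->] := spine_nth (spine_bot sp); exact: spine_dec.
Qed.

(** The sum of [f] over a set that separates the first [i.+1] vertices of the spine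
    from the others, with [U] above and [D] below. *)
Definition spine_flow i : R := \sum_(j < i.+1) Y j + \sum_(v in U) f v.

Lemma spine_flow_tail i : (i < p)%N ->
  spine_flow i = - (\sum_(i.+1 <= j < p.+1) Y j + \sum_(v in D) f v).
Proof.
move=> ip; apply/eqP; rewrite -addr_eq0; apply/eqP; rewrite -[RHS]fsum spine_sum.
rewrite -[in RHS](big_mkord xpredT (fun j => Y j)) [in RHS](big_cat_nat (n := i.+1)) 1?ltnW //=.
by rewrite big_mkord /spine_flow; ring.
Qed.

Lemma spine_flow_ge0 i : (i < p)%N -> 0 <= spine_flow i.
Proof.
move=> ip; have [Yi|Yi] := lerP 0 (Y i).
  apply: addr_ge0; last by apply: sumr_ge0 => v /(spine_U sp).
  apply: sumr_ge0 => j _; apply: le_trans Yi _.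
  by apply: spine_dec; [rewrite -ltnS | apply: ltnW].
rewrite spine_flow_tail // oppr_ge0 -oppr_ge0 opprD -!sumrN big_nat_cond.
apply: addr_ge0; last by apply: sumr_ge0 => v /(spine_D sp); rewrite oppr_ge0.
apply: sumr_ge0 => j /andP [/andP [ij jp] _].
by rewrite oppr_ge0 (le_trans _ (ltW Yi)) //; apply: spine_dec => //; apply: ltnW.
Qed.

(** Replacing the upper level set by the cut of [spine_flow] adds nonnegative
    values of [f] on [U] and removes nonpositive ones on [D]. *)
Lemma spine_cut_sum i : (i < p)%N -> Y i.+1 < Y i ->
  \sum_(v | Y i.+1 < f v) f v <= spine_flow i.
Proof.
move=> ip Yi; rewrite big_mkcond spine_sum.
have -> : \sum_(j < p.+1) (if Y i.+1 < Y j then Y j else 0) = \sum_(j < i.+1) Y j.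
  rewrite (big_ord_widen p.+1 (fun j => Y j)) 1?ltnW // [RHS]big_mkcond.
  apply: eq_bigr => j _; rewrite ltnS; congr (if _ then _ else _).
  case: (leqP j i) => ji; first by rewrite (lt_le_trans Yi) // spine_dec // ltnW.
  by apply/negbTE; rewrite -leNgt spine_dec // -ltnS.
rewrite -addrA lerD2l -[leRHS]addr0 lerD //.
  by apply: ler_sum => v /(spine_U sp) fv; case: ifP.
by apply: sumr_le0 => v /(spine_D sp) fv; case: ifP.
Qed.

Lemma spine_edge_le i x y : (i < p)%N -> Y i.+1 < Y i ->
  adj x y -> Y i.+1 < f x -> f y <= Y i.+1 -> f x - f y <= a * spine_flow i.
Proof.
move=> ip Yi xy fx fy; pose A := [pred v | Y i.+1 < f v].
apply: le_trans (_ : \sum_(u | A u) lap f u <= _).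
  apply: edge_le_flux => //=; last by rewrite -leNgt.
  by move=> u v Au; rewrite -leNgt => Av; apply: le_trans Av (ltW Au).
under eq_bigr do rewrite feig.
by rewrite -mulr_sumr ler_pM2l //; apply: spine_cut_sum.
Qed.

Lemma spine_cut_edge i : (i < p)%N -> Y i.+1 < Y i ->
  exists x y, [/\ adj x y, Y i <= f x & f y <= Y i.+1].
Proof.
move=> ip Yi; have := @spine_cross _ _ _ _ _ _ _ _ sp [pred v | Y i.+1 < f v].
rewrite /= -leNgt -spine_Y0 -spine_Yp => -[||x [y [xs ys xy fx fy]]].
- by rewrite (lt_le_trans Yi) // spine_dec // ltnW.
- exact: spine_dec.
exists x, y; split=> //; last by rewrite leNgt.
have [j jp xE] := spine_nth xs; rewrite xE in fx *.
apply: spine_dec => //; last exact: ltnW.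
by rewrite leqNgt; apply/negP => ij; move: fx; rewrite ltNge spine_dec.
Qed.

(** The path crosses from above to below the gap between two consecutive values
    of the spine, and the edge that crosses it is bounded by the total flux. *)
Lemma spine_drop i : (i < p)%N -> Y i - Y i.+1 <= a * spine_flow i.
Proof.
move=> ip; have := spine_dec (leqnSn i) ip; rewrite le_eqVlt => /predU1P [->|Yi].
  by rewrite subrr mulr_ge0 ?spine_flow_ge0 // ltW.
have [x [y [xy fx fy]]] := spine_cut_edge ip Yi.
apply: le_trans (_ : f x - f y <= _); first exact: lerB.
by apply: spine_edge_le xy _ fy => //; apply: lt_le_trans fx.
Qed.

(** The maximum [u0] has a neighbour in the spine, and no edge at [u0] carries a
    negative flux. *)
Lemma spine_first : f w0 < f u0 -> Y 0%N - Y 1%N <= a * Y 0%N.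
Proof.
move=> fwu; have := @spine_cross _ _ _ _ _ _ _ _ sp [pred v | v == u0].
rewrite /= eqxx => -[//||x [y [xs ys xy /eqP xu yu]]].
  by apply: contraTneq fwu => ->; rewrite ltxx.
rewrite xu in xy.
have Y1 : f y <= Y 1%N.
  have [j jp yE] := spine_nth ys; have [i ip uE] := spine_nth (spine_top sp).
  case: j jp yE => [|j] jp yE; last by rewrite yE spine_dec.
  case: i ip uE => [_ uE|i ip uE]; first by rewrite yE -uE eqxx in yu.
  apply: le_trans (spine_max sp y) _; rewrite {1}uE; exact: spine_dec.
apply: le_trans (_ : f u0 - f y <= _); first by rewrite spine_Y0 lerB.
rewrite spine_Y0 -feig /lap (bigD1 y) //= lerDl; apply: sumr_ge0 => v _.
by rewrite subr_ge0 (spine_max sp).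
Qed.

Lemma spine_total :
  \sum_(j < p.+1) w j * Y j = \sum_(j < p.+1) Y j + #|U|%:R * Y 0%N + #|D|%:R * Y p.
Proof.
have p0 : (0 < p)%N by apply: ltnW.
case: p p0 sz => // q _ _; rewrite big_ord_recl big_ord_recr /=.
rewrite [\sum_(j < q.+2) _]big_ord_recl [\sum_(i < q.+1) f _]big_ord_recr /=.
rewrite (eq_bigr (fun i : 'I_q => Y i.+1)) => [|i _]; last first.
  by rewrite /level_size /= /bump /= add1n eqSS (ltn_eqF (ltn_ord i)) mul1r.
by rewrite /level_size /= /bump /= !add1n eqxx -!natr1; ring.
Qed.

Lemma spine_tail i : (0 < i <= p)%N ->
  \sum_(i <= j < p.+1) w j * Y j = \sum_(i <= j < p.+1) Y j + #|D|%:R * Y p.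
Proof.
case/andP=> i0 ip; rewrite !big_nat_recr //=.
rewrite (eq_big_nat _ _ (F2 := fun j => Y j)) => [|j /andP [ij jp]]; last first.
  by rewrite /level_size (gtn_eqF (leq_trans i0 ij)) (ltn_eqF jp) mul1r.
by rewrite /level_size (gtn_eqF (leq_trans i0 ip)) eqxx -natr1; ring.
Qed.

(** Gathering all of [D] at the minimum of [f] only increases the mass below the
    cut: pendant vertices at the bottom of a broom are the extreme case. *)
Lemma spine_flow_le_tail i : (0 < i < p)%N ->
  spine_flow i <= - \sum_(i.+1 <= j < p.+1) w j * Y j.
Proof.
case/andP=> i0 ip; rewrite spine_flow_tail // spine_tail ?ip // lerN2 lerD2l.
rewrite mulr_natl -sumr_const; apply: ler_sum => v _.
by rewrite spine_Yp (spine_min sp).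
Qed.

End Spine.

Lemma spine_last (R : rcfType) (G : sgraph) (f : G -> R) a s u0 w0 U D p :
  spine f s u0 w0 U D -> size s = p.+1 -> (0 < p)%N ->
  (forall u, lap f u = a * f u) -> f w0 < f u0 ->
  f (nth u0 s p.-1) - f (nth u0 s p) <= a * - f (nth u0 s p).
Proof.
move=> sp sz p0 feig fwu; have sz' : size (rev s) = p.+1 by rewrite size_rev.
have feig' u : lap (fun v => - f v) u = a * - f u.
  by rewrite mulrN -feig /lap -sumrN; apply: eq_bigr => v _; rewrite opprB addrC opprK.
have := spine_first (spine_opp sp) sz' feig'; rewrite ltrN2 => /(_ fwu).
rewrite !nth_rev sz // subn1 subn2 /= (set_nth_default u0) ?sz //.
rewrite (set_nth_default u0 w0) ?sz // ?ltnS ?leq_pred //.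
by rewrite opprK addrC.
Qed.

(** * Comparing a graph with a double broom *)

Section SpineBound.
Variables (R : rcfType) (G : sgraph) (f : G -> R) (a : R).
Variables (s : seq G) (u0 w0 : G) (U D : {set G}) (p : nat).
Hypothesis sp : spine f s u0 w0 U D.
Hypotheses (sz : size s = p.+1) (p_gt2 : (2 < p)%N).
Hypotheses (a_gt0 : 0 < a) (a_lt1 : a < 1).
Hypothesis feig : forall u, lap f u = a * f u.
Hypothesis fsum : \sum_u f u = 0.
Hypotheses (fu0 : 0 < f u0) (fw0 : f w0 < 0).

Local Notation Y i := (f (nth u0 s i)).
Local Notation k := (#|U|.+1).
Local Notation l := (#|D|.+1).
Local Notation w i := ((level_size k l p i)%:R : R).

Let p_gt1 : (1 < p)%N. Proof. exact: ltnW. Qed.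
Let p_gt0 : (0 < p)%N. Proof. exact: ltnW. Qed.

Section Equality.
Hypothesis tot0 : \sum_(j < p.+1) w j * Y j = 0.
Hypothesis flow_eq : forall i, (i < p)%N ->
  w i * w i.+1 * (Y i - Y i.+1) = a * \sum_(j < i.+1) w j * Y j.

Let wpos i : 0 < w i.
Proof. by rewrite ltr0n /level_size; case: eqP => // _; case: eqP. Qed.

Let winner i : (0 < i < p)%N -> w i = 1.
Proof. by case/andP=> i0 ip; rewrite /level_size gtn_eqF // ltn_eqF. Qed.

Let head_tail i : (i < p)%N ->
  \sum_(j < i.+1) w j * Y j = - \sum_(i.+1 <= j < p.+1) w j * Y j.
Proof.
move=> ip; apply/eqP; rewrite -addr_eq0; apply/eqP; rewrite -[RHS]tot0.
rewrite -(big_mkord xpredT (fun j => w j * Y j)) -[RHS](big_mkord xpredT (fun j => w j * Y j)).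
by rewrite [RHS](big_cat_nat (n := i.+1)) // ltnW.
Qed.

Lemma spine_strict i : (i < p)%N -> Y i.+1 < Y i.
Proof.
move=> ip; rewrite -subr_gt0 -(pmulr_rgt0 _ (mulr_gt0 (wpos i) (wpos i.+1))).
rewrite flow_eq // pmulr_rgt0 //; have [Yi|Yi] := lerP 0 (Y i).
  rewrite big_ord_recl ltr_pwDl ?pmulr_rgt0 // ?(spine_Y0 sp sz) //.
  apply: sumr_ge0 => j _; rewrite pmulr_rge0 // (le_trans Yi) //.
  by apply: (spine_dec sp sz); rewrite ?lift0 ?ltn_ord // ltnW.
rewrite head_tail // oppr_gt0 big_nat_recr //=; apply: ltr_wnDl.
  rewrite big_nat_cond; apply: sumr_le0 => j /andP [/andP [ij jp] _].
  rewrite pmulr_rle0 // (le_trans _ (ltW Yi)) //.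
  by apply: (spine_dec sp sz); apply: ltnW.
by rewrite pmulr_rlt0 // (spine_Yp sp sz).
Qed.

Lemma spine_lt i j : (i < j)%N -> (j <= p)%N -> Y j < Y i.
Proof.
case: j => // j ij jp; apply: lt_le_trans (spine_strict jp) _.
by apply: (spine_dec sp sz) => //; apply: ltnW.
Qed.

(** The drop, the flow and the tail are in increasing order up to the factor
    [a], and the first and the last of them agree. *)
Lemma spine_flowE i : (0 < i)%N -> (i.+1 < p)%N ->
  [/\ Y i - Y i.+1 = a * spine_flow f s u0 U i
    & spine_flow f s u0 U i = - \sum_(i.+1 <= j < p.+1) w j * Y j].
Proof.
move=> i0 ip; have ip' : (i < p)%N by apply: ltnW.
have := flow_eq ip'; rewrite !winner ?i0 //= !mul1r head_tail // => dE.
have := spine_drop sp sz a_gt0 feig fsum ip'; rewrite dE ler_pM2l // => le1.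
have le2 := spine_flow_le_tail sp sz fsum (introT andP (conj i0 ip')).
by have -> : spine_flow f s u0 U i = - \sum_(i.+1 <= j < p.+1) w j * Y j
  by apply/eqP; rewrite eq_le le1 le2.
Qed.

Lemma spine_constD v : v \in D -> f v = Y p.
Proof.
have [_] := @spine_flowE 1 isT p_gt2.
rewrite (spine_flow_tail sp sz fsum) // spine_tail //.
move/oppr_inj/addrI/esym/eqP; rewrite mulr_natl -sumr_const -subr_eq0 -opprB oppr_eq0 -sumrB.
move=> /eqP; have ge0 u : u \in D -> 0 <= f u - Y p.
  by move=> _; rewrite subr_ge0 (spine_Yp sp sz) (spine_min sp).
by move/(psumr_eq0P ge0) => E /E /eqP; rewrite subr_eq0 => /eqP.
Qed.

(** Both the values on the spine weighted as in the broom and the values of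
    [f] sum to zero, so nothing is lost in replacing [f] by its maximum on
    [U]. *)
Lemma spine_constU v : v \in U -> f v = Y 0%N.
Proof.
have := tot0; rewrite (spine_total _ _ _ _ sz p_gt1) => totE.
have := fsum; rewrite (spine_sum sp sz) (eq_bigr _ spine_constD) sumr_const -mulr_natl.
move=> sumE; have : \sum_(u in U) (Y 0%N - f u) = 0.
  by rewrite sumrB sumr_const -mulr_natl; lra.
have ge0 u : u \in U -> 0 <= Y 0%N - f u.
  by move=> _; rewrite subr_ge0 (spine_Y0 sp sz) (spine_max sp).
by move/(psumr_eq0P ge0) => E /E /eqP; rewrite subr_eq0 => /eqP.
Qed.

Definition spine_level v : nat :=
  if v \in s then index v s else if v \in U then 0%N else p.

Lemma spine_level_le v : (spine_level v <= p)%N.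
Proof.
by rewrite /spine_level; case: ifP => [|_]; [rewrite -index_mem sz ltnS | case: ifP].
Qed.

Lemma spine_levelE v : f v = Y (spine_level v).
Proof.
rewrite /spine_level; case: ifP => vs; first by rewrite nth_index.
case: ifP => vU; first exact: spine_constU.
by apply: spine_constD; have := spine_cover sp v; rewrite vs vU; case: (v \in D).
Qed.

Lemma spine_level_lt u v : (spine_level u < spine_level v)%N = (f v < f u).
Proof.
rewrite (spine_levelE u) (spine_levelE v); case: (ltnP (spine_level u)) => uv.
  by rewrite spine_lt // spine_level_le.
by apply/esym/negbTE; rewrite -leNgt (spine_dec sp sz) // spine_level_le.
Qed.

Lemma spine_level_nth i : (i <= p)%N -> spine_level (nth u0 s i) = i.
Proof.
move=> ip; rewrite /spine_level mem_nth ?sz //.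
by rewrite index_uniq ?sz ?(spine_uniq sp).
Qed.

Lemma spine_level_inner v : (0 < spine_level v < p)%N -> v = nth u0 s (spine_level v).
Proof.
rewrite /spine_level; case: ifP => vs; first by rewrite nth_index.
by case: ifP => _; rewrite ?ltnn ?andbF.
Qed.

Lemma spine_level_card i : (i <= p)%N ->
  #|[set v | spine_level v == i]| = level_size k l p i.
Proof.
move=> ip; set z := nth u0 s i.
have zs : z \in s by rewrite mem_nth ?sz.
have zU : z \notin U by have := spine_cover sp z; rewrite zs; case: (z \in U).
have zD : z \notin D by have := spine_cover sp z; rewrite zs; case: (z \in D); rewrite ?addn1.
have levz v : v \in s -> (spine_level v == i) = (v == z).
  move=> vs; apply/eqP/eqP => [E|->]; last exact: spine_level_nth.
  by rewrite /z -E /spine_level vs nth_index.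
rewrite /level_size; case: (i =P 0%N) => [i0|/eqP i0].
  have -> : [set v | spine_level v == i] = z |: U.
    apply/setP => v; rewrite !inE; have [vs|vs] := boolP (v \in s).
      rewrite levz //; have := spine_cover sp v; rewrite vs.
      by case: (v \in U) => //; rewrite orbF.
    rewrite /spine_level (negbTE vs) i0; case: ifP => _; rewrite ?eqxx ?orbT //.
    by rewrite orbF gtn_eqF //; apply/esym/negbTE; apply: contraNneq vs => ->.
  by rewrite cardsU1 zU.
case: (i =P p) => [iP|/eqP iP].
  have -> : [set v | spine_level v == i] = z |: D.
    apply/setP => v; rewrite !inE; have := spine_cover sp v.
    have [vs|vs] := boolP (v \in s).
      by rewrite levz //; case: (v \in U) => //; case: (v \in D) => //; rewrite orbF.
    rewrite /spine_level (negbTE vs) iP; case: (v \in U); case: (v \in D) => //= _.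
      by rewrite orbF ltn_eqF //; apply/esym/negbTE; apply: contraNneq vs => ->.
    by rewrite eqxx orbT.
  by rewrite cardsU1 zD.
have -> : [set v | spine_level v == i] = [set z]; last exact: cards1.
apply/setP => v; rewrite !inE; have [vs|vs] := boolP (v \in s); first by rewrite levz.
have -> : (v == z) = false by apply/negbTE; apply: contraNneq vs => ->.
rewrite /spine_level (negbTE vs); case: ifP => _; first by rewrite eq_sym (negbTE i0).
by rewrite eq_sym (negbTE iP).
Qed.

(** An edge that skips a level also crosses an inner gap, where a single edge is
    bounded by the whole flux, which is no more than the width of that gap. *)
Lemma spine_adj_lt u v : (spine_level u < spine_level v)%N -> adj u v ->
  (spine_level u).+1 = spine_level v.
Proof.
move=> uv auv; apply/eqP; rewrite eqn_leq uv leqNgt; apply/negP => uv2.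
set i := spine_level u in uv uv2 *; set j := spine_level v in uv uv2 *.
have jp : (j <= p)%N by apply: spine_level_le.
(* An inner gap that the edge crosses: the first one if [i = 0]. *)
pose t := maxn 1 i.
have t0 : (0 < t)%N by rewrite /t; lia.
have tp : (t.+1 < p)%N by rewrite /t; lia.
have tj : (t.+1 <= j)%N by rewrite /t; lia.
have it : (i <= t)%N by rewrite /t; lia.
have [dE _] := spine_flowE t0 tp.
have St := spine_strict (ltnW tp).
have := spine_edge_le sp sz a_gt0 feig (ltnW tp) St auv.
rewrite -dE (spine_levelE u) (spine_levelE v) -/i -/j.
have Yit : Y t <= Y i by apply: (spine_dec sp sz) => //; lia.
have Ytj : Y j <= Y t.+1 by apply: (spine_dec sp sz).
move=> /(_ (lt_le_trans St Yit) Ytj).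
have : Y t < Y i \/ Y j < Y t.+1.
  have [it'|it'] := ltnP i t; [left; apply: spine_lt => //; lia|].
  by right; apply: spine_lt => //; rewrite /t; lia.
lra.
Qed.

(** For inner levels the edge that crosses the gap must join the two vertices
    next to it. A vertex of an extreme level has a neighbour with another
    value by the eigenvector equation, and it can only lie in the next level. *)
Lemma spine_adj_next u v : (spine_level u).+1 = spine_level v -> adj u v.
Proof.
move=> uv; set i := spine_level u in uv *.
have ip : (i < p)%N by rewrite uv spine_level_le.
have [i0|i0] := posnP i.
  have [z uz fz] : exists2 z, adj u z & f z < f u.
    apply/exists_inP; apply: contraT => /exists_inPn nz.
    have : lap f u = 0.
      apply: big1 => z uz; apply/eqP; rewrite subr_eq0 eq_le.
      rewrite leNgt nz //= (spine_levelE u) -/i i0 (spine_Y0 sp sz).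
      exact: spine_max sp _.
    rewrite feig (spine_levelE u) -/i i0 (spine_Y0 sp sz) => /eqP.
    by rewrite mulf_eq0 !gt_eqF.
  have zE : i.+1 = spine_level z by apply: spine_adj_lt => //; rewrite spine_level_lt.
  suff -> : v = z by [].
  rewrite (spine_level_inner (v := v)) -?uv ?i0 ?p_gt1 //.
  by rewrite (spine_level_inner (v := z)) -?zE ?i0 ?p_gt1.
have [ip1|ip1] := ltnP i.+1 p.
  have [x [y [xy fx fy]]] := spine_cut_edge sp sz ip (spine_strict ip).
  have xi : (spine_level x <= i)%N.
    by rewrite leqNgt -{1}(spine_level_nth (ltnW ip)) spine_level_lt -leNgt.
  have yi : (i < spine_level y)%N.
    by rewrite ltnNge -ltnS -[X in (_ < X)%N](spine_level_nth (i := i.+1)) // spine_level_lt -leNgt.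
  have xyE : (spine_level x).+1 = spine_level y.
    by apply: spine_adj_lt => //; apply: leq_ltn_trans yi.
  have xE : spine_level x = i by lia.
  have yE : spine_level y = i.+1 by lia.
  have -> : u = x.
    rewrite (spine_level_inner (v := u)) -/i ?i0 ?ip //.
    by rewrite (spine_level_inner (v := x)) xE ?i0 ?ip.
  suff -> : v = y by [].
  rewrite (spine_level_inner (v := v)) -?uv ?ip1 //.
  by rewrite (spine_level_inner (v := y)) yE ?ip1.
have iE : i.+1 = p by lia.
have [z vz fz] : exists2 z, adj v z & f v < f z.
  apply/exists_inP; apply: contraT => /exists_inPn nz.
  have : lap f v = 0.
    apply: big1 => z vz; apply/eqP; rewrite subr_eq0 eq_le.
    rewrite [f z <= _]leNgt nz //= andbT (spine_levelE v) -uv iE (spine_Yp sp sz).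
    exact: spine_min sp _.
  rewrite feig (spine_levelE v) -uv iE (spine_Yp sp sz) => /eqP.
  by rewrite mulf_eq0 gt_eqF // lt_eqF.
have zE : (spine_level z).+1 = spine_level v.
  by apply: spine_adj_lt; [rewrite spine_level_lt | rewrite adj_sym].
have zi : spine_level z = i by lia.
suff -> : u = z by rewrite adj_sym.
rewrite (spine_level_inner (v := u)) -/i ?i0 ?ip //.
by rewrite (spine_level_inner (v := z)) zi ?i0 ?ip.
Qed.

Lemma spine_leveling : leveling k l p spine_level.
Proof.
split; [exact: spine_level_le | exact: spine_level_card |].
move=> u v; wlog uv : u v / (spine_level u < spine_level v)%N => [IH|_].
  rewrite neq_ltn => /orP [uv|uv]; first by rewrite IH // ltn_eqF.
  by rewrite adj_sym IH // ?ltn_eqF // /consecutive orbC.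
rewrite /consecutive; have -> : ((spine_level v).+1 == spine_level u) = false by lia.
rewrite orbF; apply/idP/eqP; first exact: spine_adj_lt.
exact: spine_adj_next.
Qed.

End Equality.

(** The values of [f] along the spine give, through [test_sequence], a test
    sequence on the double broom whose pendant vertices are counted by [U] and
    [D]; if the bound is attained, [f] itself exhibits the level structure. *)
Lemma spine_bound (B : sgraph) (ellB : B -> nat) : broom_leveling k l p ellB ->
  0 <= \sum_(j < p.+1) w j * Y j ->
  algebraic_connectivity R B <= a /\
  (a <= algebraic_connectivity R B -> exists ell : G -> nat, leveling k l p ell).
Proof.
move=> brB tot.
have [] := @test_sequence R B k l p ellB brB isT isT p_gt1 (fun j => Y j) a a_gt0 a_lt1.
- by move=> i ip; apply: (spine_dec sp sz).
- by rewrite (spine_Yp sp sz).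
- exact: (spine_first sp sz feig (lt_trans fw0 fu0)).
- move=> i /andP [i0 ip]; have wi : w i = 1 by rewrite /level_size (gtn_eqF i0) (ltn_eqF ip).
  rewrite wi mul1r; have [ip1|ip1] := ltnP i.+1 p.
    rewrite [level_size _ _ _ i.+1]/level_size (ltn_eqF ip1) mul1r.
    apply: le_trans (spine_drop sp sz a_gt0 feig fsum ip) _.
    by rewrite ler_pM2l // (spine_flow_le_tail sp sz fsum) // i0.
  have iE : i.+1 = p by apply/eqP; rewrite eqn_leq ip.
  rewrite iE big_nat1 -mulrN mulrCA ler_pM2l.
    by have := spine_last sp sz p_gt0 feig (lt_trans fw0 fu0); rewrite -[in p.-1]iE.
  by rewrite ltr0n /level_size gtn_eqF // eqxx.
- by [].
move=> ? H; split=> // /H [H1 H2]; exists spine_level; exact: spine_leveling.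
Qed.

End SpineBound.

(** * Monotone Fiedler vectors of double brooms *)

(** At a pendant vertex [u] with neighbour [x] the eigenvector equation reads
    [(1 - c) * f u = f x]. *)
Lemma leaf_eigen (R : rcfType) (G : sgraph) k l p (ell : G -> nat) (f : G -> R) c :
  (1 < p)%N -> broom_leveling k l p ell -> c < 1 -> (forall u, lap f u = c * f u) ->
  forall u v, ell u = 0%N -> ell v = 0%N -> f u = f v.
Proof.
move=> p1 [lv nadj] c1 feig u v u0 v0.
have /eqP/cards1P [x xE] : #|[set x | ell x == 1%N]| = 1%N.
  by rewrite (level_card lv (ltnW p1)) /level_size /= ltn_eqF.
have leaf t : ell t = 0%N -> (1 - c) * f t = f x.
  move=> t0; have : lap f t = f t - f x.
    rewrite /lap (eq_bigl (pred1 x)) ?big_pred1_eq // => y /=.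
    have -> : (y == x) = (ell y == 1%N) by rewrite -in_set1 -xE inE.
    have [ty|ty] := eqVneq (ell t) (ell y).
      by rewrite (negbTE (nadj _ _ ty)) -ty t0.
    by rewrite (level_adj lv ty) t0 /consecutive orbF eq_sym.
  by rewrite feig; lra.
have c0 : 1 - c != 0 by rewrite gt_eqF // subr_gt0.
by apply: (mulfI c0); rewrite !leaf.
Qed.

Lemma sum_sqr_diff (R : comNzRingType) (I : finType) (F : I -> R) :
  \sum_u \sum_v (F u - F v) ^+ 2
  = #|I|%:R * (\sum_u F u ^+ 2) *+ 2 - (\sum_u F u) ^+ 2 *+ 2.
Proof.
have -> : \sum_u \sum_v (F u - F v) ^+ 2
  = \sum_u (#|I|%:R * F u ^+ 2 - F u * (\sum_v F v) *+ 2 + \sum_v F v ^+ 2).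
  apply: eq_bigr => u _; rewrite mulr_natl -sumr_const mulr_sumr -sumrMnl.
  by rewrite -sumrB -big_split; apply: eq_bigr => v _ /=; ring.
rewrite big_split sumrB /= sumr_const -mulr_sumr sumrMnl -mulr_suml -mulr_natl.
by rewrite expr2; ring.
Qed.

Section MonotoneFiedler.
Variables (R : rcfType) (B : sgraph) (k l p : nat) (ell : B -> nat).
Hypothesis brB : broom_leveling k l p ell.
Hypotheses (k_gt0 : (0 < k)%N) (l_gt0 : (0 < l)%N) (p_gt1 : (1 < p)%N).
Local Notation a := (algebraic_connectivity R B).
Hypotheses (a_gt0 : 0 < a) (a_lt1 : a < 1).

Let p_gt0 : (0 < p)%N. Proof. exact: ltnW. Qed.

Lemma eigen_level (f : B -> R) : (forall u, lap f u = a * f u) ->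
  exists y : nat -> R, forall v, f v = y (ell v).
Proof.
move=> feig; exists (fun i => if [pick v | ell v == i] is Some v then f v else 0).
move=> v; case: pickP => [u /eqP uv|/(_ v)]; last by rewrite eqxx.
have [v0|v0] := posnP (ell v).
  by apply: (leaf_eigen p_gt1 brB a_lt1 feig); rewrite ?uv.
have [vp|vp] := leqP p (ell v).
  have vE : ell v = p by apply/eqP; rewrite eqn_leq vp (level_le brB.1).
  apply: (leaf_eigen p_gt1 (broom_leveling_rev p_gt0 brB) a_lt1 feig) => /=.
    by rewrite vE subnn.
  by rewrite uv vE subnn.
have /eqP/cards1P [x xE] : #|[set x | ell x == ell v]| = 1%N.
  by rewrite (level_card brB.1) ?(ltnW vp) // /level_size gtn_eqF // ltn_eqF.
have : v \in [set x | ell x == ell v] by rewrite inE.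
have : u \in [set x | ell x == ell v] by rewrite inE uv.
by rewrite xE !inE => /eqP -> /eqP ->.
Qed.

(** Replacing the drops of a Fiedler vector along the levels by their absolute
    values keeps the energy and can only increase the variance, so the
    rearranged vector is again a minimiser. *)
Lemma broom_monotone_fiedler : exists y : nat -> R,
  [/\ forall i, (i < p)%N -> y i.+1 <= y i, \sum_v y (ell v) = 0,
      forall u, lap (y \o ell) u = a * y (ell u)
    & exists v, y (ell v) != 0].
Proof.
have B1 : (1 < #|B|)%N by rewrite (broom_card p_gt0 brB.1); lia.
have [f [[u fu] fs feig]] := fiedler_vector R B1.
have [y fy] := eigen_level feig.
pose h i := - \sum_(j < i) `|y j - y j.+1|.
have hS i : h i - h i.+1 = `|y i - y i.+1| by rewrite /h big_ord_recr /=; lra.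
have hle i j : (i <= j)%N -> `|y i - y j| <= h i - h j.
  move/subnK <-; elim: (j - i)%N => [|m IHm]; first by rewrite !subrr normr0.
  rewrite addSn; have := hS (m + i)%N.
  have := ler_normD (y i - y (m + i)%N) (y (m + i)%N - y (m + i).+1).
  by rewrite addrA subrK; lra.
have nsqr (x : R) : `|x| ^+ 2 = x ^+ 2 by rewrite real_normK ?num_real.
pose n : R := #|B|%:R.
have n0 : 0 < n by rewrite ltr0n ltnW.
pose mu := (\sum_v h (ell v)) / n.
pose g i := h i - mu.
have gs : \sum_v g (ell v) = 0.
  rewrite sumrB sumr_const -mulr_natr /mu divfK ?subrr //; exact: lt0r_neq0.
have fpos : 0 < \sum_v f v ^+ 2.
  rewrite (bigD1 u) //= ltr_pwDl ?sumr_ge0 // => [|v _]; last exact: sqr_ge0.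
  by rewrite lt0r sqrf_eq0 fu sqr_ge0.
have fg : \sum_v f v ^+ 2 <= \sum_v g (ell v) ^+ 2.
  have : \sum_u \sum_v (f u - f v) ^+ 2 <= \sum_u \sum_v (g (ell u) - g (ell v)) ^+ 2.
    apply: ler_sum => s _; apply: ler_sum => t _; rewrite !fy.
    have gE i j : g i - g j = h i - h j by rewrite /g; lra.
    rewrite gE -[leLHS]nsqr -[leRHS]nsqr.
    rewrite ler_sqr ?nnegrE //.
    case: (leqP (ell s) (ell t)) => st; last rewrite distrC [leRHS]distrC.
      exact: le_trans (hle _ _ st) (ler_norm _).
    exact: le_trans (hle _ _ (ltnW st)) (ler_norm _).
  rewrite !sum_sqr_diff fs gs expr0n /= mul0rn !subr0 lerMn2r /=.
  by rewrite ler_pM2l.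
have gmin : dirichlet (g \o ell) (g \o ell) <= a * \sum_v g (ell v) ^+ 2.
  apply: le_trans (_ : a * \sum_v f v ^+ 2 <= _); last by rewrite ler_pM2l.
  have -> : a * \sum_v f v ^+ 2 = dirichlet (y \o ell) (y \o ell).
    rewrite mulr_sumr /dirichlet; apply: eq_bigr => v _ /=.
    have -> : lap (y \o ell) v = lap f v.
      by apply: eq_bigr => t _; rewrite !fy.
    by rewrite feig fy; ring.
  rewrite !(level_dirichlet brB.1 brB.2); apply: ler_sum => i _.
  rewrite ler_wpM2l ?mulr_ge0 // -!expr2.
  have -> : g i - g i.+1 = `|y i - y i.+1| by rewrite -hS /g; lra.
  by rewrite nsqr.
have geig := dirichlet_minimizer_eigen B1 gs gmin.
exists g; split=> //.
  by move=> i _; rewrite -subr_ge0; have := hS i; have := normr_ge0 (y i - y i.+1); rewrite /g; lra.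
apply/existsP; apply: contraT => /existsPn g0; move: (lt_le_trans fpos fg).
rewrite big1 ?ltxx // => v _; move: (g0 v); rewrite negbK => /eqP ->.
by rewrite expr0n.
Qed.

End MonotoneFiedler.

(** * The two ends of an unbalanced double broom *)

Section HeavyEnd.
Variables (R : rcfType) (k l p : nat) (a : R) (y : nat -> R).
Local Notation w i := ((level_size k l p i)%:R : R).
Hypotheses (l_gt0 : (0 < l)%N) (lk : (l < k)%N) (p_gt2 : (2 < p)%N).
Hypotheses (a_gt0 : 0 < a) (a_lt1 : a < 1).
Hypothesis ydec : forall i, (i < p)%N -> y i.+1 <= y i.
Let C i := \sum_(j < i.+1) w j * y j.
Hypothesis flow : forall i, (i < p)%N -> w i * w i.+1 * (y i - y i.+1) = a * C i.
Hypothesis Cp : C p = 0.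
Hypotheses (y0_gt0 : 0 < y 0%N) (yp_lt0 : y p < 0).

Let w0 : w 0%N = k%:R. Proof. by []. Qed.
Let winner i : (0 < i < p)%N -> w i = 1.
Proof. by case/andP=> i0 ip; rewrite /level_size gtn_eqF // ltn_eqF. Qed.
Let wp : w p = l%:R.
Proof. by rewrite /level_size eqxx gtn_eqF // (ltn_trans _ p_gt2). Qed.
Let CS i : (i.+1 < p)%N -> C i.+1 = C i + y i.+1.
Proof. by move=> ip; rewrite /C big_ord_recr /= winner ?ip // mul1r. Qed.
Let Clast : C p.-1 = - (l%:R * y p).
Proof.
have gen n : C n.+1 = C n + w n.+1 * y n.+1 by rewrite /C big_ord_recr.
by have := gen p.-1; rewrite prednK ?Cp ?wp; [lra | lia].
Qed.
Let y1E : y 1%N = (1 - a) * y 0%N.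
Proof.
have kn0 : (k%:R : R) != 0 by rewrite pnatr_eq0; lia.
have := flow (ltnW (ltnW p_gt2)); rewrite /C big_ord1 w0 (winner (i := 1)) ?mulr1 //=; last exact: ltnW.
by rewrite mulrCA => /(mulfI kn0); lra.
Qed.
Let yp1E : y p.-1 = (1 - a) * y p.
Proof.
have ln0 : (l%:R : R) != 0 by rewrite pnatr_eq0; lia.
have pp : (p.-1 < p)%N by lia.
have wp1 : w p.-1 = 1 by apply: winner; lia.
have := flow pp; rewrite Clast wp1 prednK ?wp ?mul1r; last lia.
by rewrite -mulrN mulrCA => /(mulfI ln0); lra.
Qed.
Let yS i : (0 < i)%N -> (i.+1 < p)%N -> y i.+1 = y i - a * C i.
Proof.
move=> i0 ip; have := flow (ltnW ip).
by rewrite !winner ?i0 ?(ltnW ip) // !mul1r => <-; ring.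
Qed.

Let ymono i j : (i <= j)%N -> (j <= p)%N -> y j <= y i.
Proof.
move/subnK <-; elim: (j - i)%N => // m IHm mp; rewrite addSn in mp *.
by apply: le_trans (ydec mp) (IHm _); apply: ltnW.
Qed.

(** Suppose the heavier end had the larger amplitude, and compare the sequence
    read from the top, [y], with the one read from the bottom, [z]. Let [T] be
    the difference of their masses [C]. Both [T] and [z] solve the second
    order recursion of a path, so their discrete Wronskian [W] is constant; it
    is nonnegative at the first index, so [T] stays positive as long as [z]
    does. But at the last index where [z] is positive the mass read from the
    bottom is maximal, and both masses are values of the same function [C] as
    the total mass is zero: a contradiction. *)
Lemma heavy_end_small : y 0%N < - y p.
Proof.
rewrite ltNge; apply/negP => y0p.
pose z i := - y (p - i)%N; pose T i := C i - C (p.-1 - i)%N.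
have zS i : (0 < i)%N -> (i.+1 < p)%N -> z i.+1 = z i - a * C (p.-1 - i)%N.
  move=> i0 ip; rewrite /z; have -> : (p - i.+1)%N = (p.-1 - i)%N by lia.
  have -> : (p - i)%N = (p.-1 - i).+1 by lia.
  by rewrite yS; [ring | lia | lia].
have CrS i : (i.+1 < p)%N -> C (p.-1 - i.+1)%N = C (p.-1 - i)%N + z i.+1.
  move=> ip; have -> : (p.-1 - i)%N = (p.-1 - i.+1).+1 by lia.
  rewrite CS; last lia.
  rewrite /z; have -> : (p - i.+1)%N = (p.-1 - i.+1).+1 by lia.
  by ring.
have TS i : (i.+1 < p)%N -> T i.+1 = T i + y i.+1 - z i.+1.
  by move=> ip; rewrite /T CS // CrS //; ring.
have z1 : z 1%N = - y p.-1 by rewrite /z subn1.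
have z1_gt0 : 0 < z 1%N.
  by rewrite z1 yp1E -mulrN mulr_gt0 ?subr_gt0 // oppr_gt0.
have Cr1 : C (p.-1 - 1)%N = - (l%:R * y p) + z 1%N.
  rewrite z1 -Clast subn1; have -> : p.-1 = p.-2.+1 by lia.
  by rewrite CS ?addrK //; lia.
have kl : (l%:R + 1 : R) <= k%:R by rewrite natr1 ler_nat.
have l0 : (0 : R) < l%:R by rewrite ltr0n.
have y1z1 : z 1%N <= y 1%N.
  by rewrite z1 yp1E y1E -mulrN ler_pM2l // subr_gt0.
have T1_gt0 : 0 < T 1%N.
  rewrite /T Cr1 CS ?(ltn_trans _ p_gt2) // /C big_ord1 w0.
  have : l%:R * - y p <= l%:R * y 0%N by rewrite ler_pM2l.
  have : (l%:R + 1) * y 0%N <= k%:R * y 0%N by rewrite ler_pM2r.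
  by rewrite mulrN mulrDl mul1r; move: y1z1 y0_gt0; lra.
pose W i := T i.+1 * z i - T i * z i.+1.
have W_ge0 i : (0 < i)%N -> (i.+1 < p)%N -> 0 <= W i.
  case: i => // i _; elim: i => [|i IHi] ip.
    have -> : W 1%N = (y 1%N - z 1%N) * z 1%N + a * (T 1%N * (- (l%:R * y p))).
      rewrite /W TS // zS // yS // Cr1.
      have -> : C 1%N = T 1%N + (- (l%:R * y p) + z 1%N) by rewrite /T Cr1; ring.
      by ring.
    apply: addr_ge0; first by rewrite mulr_ge0 ?subr_ge0 // ltW.
    by rewrite mulr_ge0 1?ltW // mulr_gt0 // -mulrN mulr_gt0 // oppr_gt0.
  have -> : W i.+2 = W i.+1; last exact: IHi (ltnW ip).
  have ip' : (i.+2 < p)%N by apply: ltnW.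
  have z3 : z i.+3 = (2 - a) * z i.+2 - z i.+1.
    have c1 := zS i.+1 isT ip'; have c2 := zS i.+2 isT ip.
    by rewrite c2 (CrS i.+1) // mulrDr; move: c1; lra.
  have T3 : T i.+3 = (2 - a) * T i.+2 - T i.+1.
    have c2 := zS i.+2 isT ip; have d2 := yS (isT : 0 < i.+2)%N ip.
    have CE : a * C i.+2 = a * T i.+2 + a * C (p.-1 - i.+2)%N by rewrite /T; ring.
    by have t1 := TS i.+1 ip'; rewrite (TS i.+2) // c2 d2 CE; move: t1; lra.
  by rewrite /W T3 z3; ring.
have T_gt0 i : (0 < i)%N -> (i < p)%N -> 0 < z i -> 0 < T i.
  case: i => // i _; elim: i => [//|i IHi] ip zi.
  have zz : z i.+2 <= z i.+1 by rewrite /z lerN2 ymono ?leq_sub2l ?leq_subr.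
  have zi1 := lt_le_trans zi zz.
  have Ti := IHi (ltnW ip) zi1.
  rewrite -(pmulr_lgt0 _ zi1); apply: lt_le_trans (_ : T i.+1 * z i.+2 <= _).
    exact: mulr_gt0.
  by rewrite -subr_ge0; apply: W_ge0.
(* [r] is the last nonnegative level, where [C] is maximal; read from the
   bottom, the last index with a positive value is [p.-1 - r]. *)
have [r [r1 rp yr yr1]] : exists r, [/\ (0 < r)%N, (r.+1 < p)%N, 0 <= y r & y r.+1 < 0].
  pose P i := (0 <= y i) && (i < p)%N.
  have P1 : P 1%N by rewrite /P y1E mulr_ge0 ?subr_ge0 1?ltW //=; apply: ltnW.
  have Pub i : P i -> (i <= p)%N by case/andP => _ /ltnW.
  case: (ex_maxnP (ex_intro P 1%N P1) Pub) => r /andP [yr rp] rmax.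
  have yr1 : y r.+1 < 0.
    rewrite ltNge; apply/negP => yr1; have [rp1|rp1] := ltnP r.+1 p.
      by have := rmax r.+1; rewrite /P yr1 rp1 ltnn => /(_ isT).
    have rE : r.+1 = p by apply/eqP; rewrite eqn_leq rp.
    by move: yr1; rewrite rE leNgt yp_lt0.
  exists r; split=> //; first exact: rmax.
  rewrite ltn_neqAle rp andbT; apply/eqP => rE; move: yr; have -> : r = p.-1 by rewrite -rE.
  by rewrite yp1E pmulr_rge0 ?subr_gt0 // leNgt yp_lt0.
have Cup m i : (i + m <= r)%N -> C i <= C (i + m)%N.
  elim: m => [|m IHm] mr; first by rewrite addn0.
  rewrite addnS in mr *; apply: le_trans (IHm (ltnW mr)) _.
  have q : ((i + m).+1 < p)%N by apply: leq_ltn_trans mr (ltnW rp).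
  rewrite (CS q) lerDl (le_trans yr) // ymono //.
  exact: ltnW (ltnW rp).
have Cdn m : (r + m < p)%N -> C (r + m)%N <= C r.
  elim: m => [|m IHm] mr; first by rewrite addn0.
  rewrite addnS in mr *; apply: le_trans _ (IHm (ltnW mr)); rewrite (CS mr) gerDl.
  apply: le_trans (ltW yr1); apply: ymono; first by rewrite ltnS leq_addr.
  exact: ltnW.
have := @T_gt0 (p.-1 - r)%N; rewrite /T /z.
have -> : (p.-1 - (p.-1 - r))%N = r by move: rp; clear; lia.
have -> : (p - (p.-1 - r))%N = r.+1 by move: rp; clear; lia.
rewrite oppr_gt0 => /(_ _ _ yr1); rewrite subr_gt0 => H.
have q0 : (0 < p.-1 - r)%N by move: rp; clear; lia.
have qp : (p.-1 - r < p)%N by move: rp; clear; lia.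
have := H q0 qp; rewrite ltNge => /negP; apply.
case: (leqP (p.-1 - r) r) => rq; first by have := Cup _ _ (eq_leq (subnKC rq)); rewrite subnKC.
by have := Cdn (p.-1 - r - r)%N; rewrite subnKC ?(ltnW rq) //; apply.
Qed.
End HeavyEnd.

(** * Balancing a double broom *)

Section Balance.
Variables (R : rcfType) (q : nat).
Local Notation p := q.+3.
Local Notation w k l i := ((level_size k l p i)%:R : R).

Lemma level_sumE k l (F : nat -> R) : \sum_(i < p.+1) w k l i * F i
  = k%:R * F 0%N + \sum_(i < q.+2) F i.+1 + l%:R * F p.
Proof.
rewrite big_ord_recl big_ord_recr /= addrA; congr (_ + _ + _).
  apply: eq_bigr => i _; rewrite /level_size /= /bump /= add1n eqSS.
  by rewrite (ltn_eqF (ltn_ord i)) mul1r.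
by rewrite /level_size /= /bump /= add1n eqxx.
Qed.

Lemma edge_sumE k l (F : nat -> R) :
  \sum_(i < p) w k l i * w k l i.+1 * F i
  = k%:R * F 0%N + \sum_(i < q.+1) F i.+1 + l%:R * F q.+2.
Proof.
rewrite big_ord_recl big_ord_recr /= addrA; congr (_ + _ + _).
- by rewrite /level_size /= mulr1.
- apply: eq_bigr => i _; rewrite /level_size /= /bump /= !add1n !eqSS.
  by rewrite (ltn_eqF (ltn_ord i)) (ltn_eqF (ltn_trans (ltn_ord i) (ltnSn _))) !mul1r.
by rewrite /level_size /= /bump /= !add1n eqxx !eqSS (ltn_eqF (ltnSn _)) mul1r.
Qed.

(** The bilinear form of the Laplacian minus [a], restricted to functions of
    the level. *)
Definition level_form (a : R) k l (x y : nat -> R) : R :=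
  \sum_(i < p) w k l i * w k l i.+1 * ((x i - x i.+1) * (y i - y i.+1))
  - a * \sum_(i < p.+1) w k l i * (x i * y i).

Lemma level_formE (G : sgraph) k l ell (a : R) (x y : nat -> R) :
  @broom_leveling G k l p ell ->
  level_form a k l x y
  = dirichlet (x \o ell) (y \o ell) - a * \sum_v x (ell v) * y (ell v).
Proof.
move=> [lv nadj]; rewrite /level_form (level_dirichlet lv nadj).
by rewrite (sum_level (fun i => x i * y i) lv).
Qed.

Lemma level_formDZl a k l c1 c2 (x y z : nat -> R) :
  level_form a k l (fun i => c1 * x i + c2 * y i) z
  = c1 * level_form a k l x z + c2 * level_form a k l y z.
Proof.
rewrite /level_form.
have E1 F1 F2 F3 (r := index_enum 'I_p) : (forall i, F3 i = c1 * F1 i + c2 * F2 i) ->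
    \sum_(i <- r) F3 i = c1 * (\sum_(i <- r) F1 i) + c2 * \sum_(i <- r) F2 i :> R.
  by move=> E; rewrite !mulr_sumr -big_split; apply: eq_bigr => i _; rewrite E.
have E2 F1 F2 F3 (r := index_enum 'I_p.+1) : (forall i, F3 i = c1 * F1 i + c2 * F2 i) ->
    \sum_(i <- r) F3 i = c1 * (\sum_(i <- r) F1 i) + c2 * \sum_(i <- r) F2 i :> R.
  by move=> E; rewrite !mulr_sumr -big_split; apply: eq_bigr => i _; rewrite E.
rewrite (E1 (fun i => w k l i * w k l i.+1 * ((x i - x i.+1) * (z i - z i.+1)))
  (fun i => w k l i * w k l i.+1 * ((y i - y i.+1) * (z i - z i.+1)))) => [|i]; last by ring.
rewrite (E2 (fun i => w k l i * (x i * z i)) (fun i => w k l i * (y i * z i))) => [|i]; last by ring.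
by ring.
Qed.

Lemma level_formC a k l (x y : nat -> R) : level_form a k l x y = level_form a k l y x.
Proof.
by rewrite /level_form; congr (_ - _ * _); apply: eq_bigr => i _; ring.
Qed.

Lemma level_form_reweight a k l k' l' x y :
  level_form a k' l' x y = level_form a k l x y
   + (k'%:R - k%:R) * ((x 0%N - x 1%N) * (y 0%N - y 1%N) - a * (x 0%N * y 0%N))
   + (l'%:R - l%:R) * ((x q.+2 - x p) * (y q.+2 - y p) - a * (x p * y p)).
Proof.
rewrite /level_form !(edge_sumE _ _ (fun i => (x i - x i.+1) * (y i - y i.+1))).
rewrite !(level_sumE _ _ (fun i => x i * y i)).
by ring.
Qed.

Lemma level_form_rev a k l x y :
  level_form a k l (fun i => x (p - i)%N) (fun i => y (p - i)%N)
  = level_form a l k x y.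
Proof.
have wrev i : (i <= p)%N -> level_size l k p (p - i) = level_size k l p i.
  move=> ip; rewrite /level_size.
  by case: (i =P 0%N) => ?; case: (i =P p) => ?; case: ((p - i)%N =P 0%N) => ?;
     case: ((p - i)%N =P p) => ?; lia.
rewrite /level_form; congr (_ - _ * _).
  rewrite [RHS](reindex_inj rev_ord_inj) /=; apply: eq_bigr => i _.
  have ip := ltn_ord i; have -> : (p - i.+1).+1 = (p - i)%N by lia.
  by rewrite !wrev ?(ltnW ip) //; ring.
rewrite [RHS](reindex_inj rev_ord_inj) /=; apply: eq_bigr => i _.
by rewrite subSS wrev // -ltnS.
Qed.

(** Let [y] be a monotone Fiedler vector of the unbalanced broom and [yr] its
    mirror image, both read on the new broom. Moving pendant vertices changes
    the form of the Laplacian minus [a] only through its values at the ends;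
    as the total number of pendant vertices is unchanged, [y] and [yr] remain
    orthogonal for that form, and by [heavy_end_small] it is negative on both.
    It is thus negative definite on a plane, which contains a nonzero vector of
    mean zero. *)
Lemma balance_decreases (B T : sgraph) k l k' l' (ellB : B -> nat) (ellT : T -> nat) :
  broom_leveling k l p ellB -> broom_leveling k' l' p ellT ->
  (0 < l)%N -> (0 < k')%N -> (0 < l')%N -> (k + l = k' + l')%N ->
  (k' < k)%N -> (l' < k)%N ->
  0 < algebraic_connectivity R B -> algebraic_connectivity R B < 1 ->
  algebraic_connectivity R T < algebraic_connectivity R B.
Proof.
move=> brB brT l0 k'0 l'0 kl k'k l'k a0 a1.
have k0 : (0 < k)%N by apply: leq_ltn_trans k'k.
have lk : (l < k)%N by lia.
have [y [ydec ysum yeig [v yv]]] := broom_monotone_fiedler brB k0 l0 isT a0 a1.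
set a := algebraic_connectivity R B in a0 a1 yeig *.
have flow := level_flow brB.1 brB.2 yeig.
have Csum : \sum_(i < p.+1) w k l i * y i = 0 by rewrite -(sum_level y brB.1).
have ymono i j : (i <= j)%N -> (j <= p)%N -> y j <= y i.
  move/subnK <-; elim: (j - i)%N => // m IHm mp; rewrite addSn in mp *.
  by apply: le_trans (ydec _ mp) (IHm _); apply: ltnW.
have wpos i : 0 < w k l i by rewrite ltr0n /level_size; case: eqP => // _; case: eqP.
have ynz : exists i : 'I_p.+1, w k l i * y i != 0.
  have vp : (ellB v < p.+1)%N by rewrite ltnS (level_le brB.1).
  by exists (Ordinal vp); rewrite mulf_neq0 // gt_eqF.
have y0 : 0 < y 0%N.
  rewrite ltNge; apply/negP => y0; have [i /eqP] := ynz; apply.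
  apply/eqP; rewrite -oppr_eq0; apply/eqP.
  apply: (psumr_eq0P (P := xpredT) (F := fun i : 'I_p.+1 => - (w k l i * y i))) => //.
    move=> j _; rewrite oppr_ge0 pmulr_rle0 //; exact: le_trans (ymono 0%N j (leq0n _) (ltn_ord j)) y0.
  by rewrite sumrN Csum oppr0.
have yp : y p < 0.
  rewrite ltNge; apply/negP => yp; have [i /eqP] := ynz; apply.
  apply: (psumr_eq0P (P := xpredT) (F := fun i : 'I_p.+1 => w k l i * y i)) => //.
  move=> j _; rewrite pmulr_rge0 //; exact: le_trans yp (ymono j p (ltn_ord j) (leqnn _)).
have small := heavy_end_small l0 lk (isT : 2 < p)%N a0 a1 ydec flow Csum y0 yp.
have kn0 : (k%:R : R) != 0 by rewrite pnatr_eq0 -lt0n.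
have ln0 : (l%:R : R) != 0 by rewrite pnatr_eq0 -lt0n.
have y1E : y 0%N - y 1%N = a * y 0%N.
  have := flow 0%N isT; rewrite big_ord1 /level_size /= mulr1 [RHS]mulrCA.
  exact: mulfI.
have ypE : y q.+2 - y p = - (a * y p).
  have := flow q.+2 (ltnSn _).
  have -> : \sum_(j < p) w k l j * y j = - (l%:R * y p).
    apply/eqP; rewrite -addr_eq0; apply/eqP; rewrite -[RHS]Csum [RHS]big_ord_recr /=.
    by rewrite /level_size eqxx.
  rewrite /level_size /= eqxx eqSS (ltn_eqF (ltnSn _)) mul1r.
  by rewrite mulrN mulrCA -mulrN => /(mulfI ln0).
pose yr i := y (p - i)%N.
have form0 x : level_form a k l x y = 0.
  rewrite (level_formE _ _ _ brB) /dirichlet mulr_sumr -sumrB; apply: big1 => u _.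
  by rewrite yeig /=; ring.
pose b := a * (1 - a).
have b0 : 0 < b by rewrite mulr_gt0 // subr_gt0.
have klR : l'%:R - l%:R = k%:R - k'%:R :> R.
  by have : (k + l)%:R = (k' + l')%:R :> R; [rewrite kl | rewrite !natrD; lra].
have lkR : l'%:R - k%:R = l%:R - k'%:R :> R by move: klR; lra.
have Qyy : level_form a k' l' y y = - ((k%:R - k'%:R) * (b * (y p ^+ 2 - y 0%N ^+ 2))).
  by rewrite (level_form_reweight a k l) form0 y1E ypE klR /b; ring.
have Qrr : level_form a k' l' yr yr = - ((k%:R - l'%:R) * (b * (y p ^+ 2 - y 0%N ^+ 2))).
  rewrite /yr level_form_rev (level_form_reweight a k l) form0 y1E ypE lkR.
  have -> : k'%:R - l%:R = k%:R - l'%:R :> R by move: klR; lra.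
  have -> : l%:R - k'%:R = - (k%:R - l'%:R) :> R by move: klR; lra.
  by rewrite /b; ring.
have Qyr : level_form a k' l' yr y = 0.
  rewrite (level_form_reweight a k l) form0 y1E ypE klR /yr.
  have -> : (p - 0)%N = p by [].
  have -> : (p - 1)%N = q.+2 by rewrite subn1.
  have -> : (p - q.+2)%N = 1%N by rewrite subSn ?subnn.
  rewrite subnn; have -> : y p - y q.+2 = a * y p by rewrite -opprB ypE opprK.
  have -> : y 1%N - y 0%N = - (a * y 0%N) by rewrite -y1E opprB.
  by ring.
(* The weights for which the combination has mean zero on the new broom. *)
pose c1 : R := k%:R - l'%:R; pose c2 : R := - (k%:R - k'%:R).
have c1pos : 0 < c1 by rewrite subr_gt0 ltr_nat.
have c2neg : 0 < k%:R - k'%:R :> R by rewrite subr_gt0 ltr_nat.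
pose x i := c1 * y i + c2 * yr i.
have T1 : (1 < #|T|)%N by rewrite (broom_card (ltn0Sn _) brT.1); move: k'0; clear; lia.
have xsum : \sum_u x (ellT u) = 0.
  have E1 : \sum_(i < p.+1) w k' l' i * y i = (k%:R - k'%:R) * (y p - y 0%N).
    move: Csum; rewrite !(level_sumE _ _ y) => Csum.
    have -> : (k%:R - k'%:R) * (y p - y 0%N) = (l'%:R - l%:R) * y p - (k%:R - k'%:R) * y 0%N
      by rewrite klR; ring.
    by move: Csum; lra.
  have E2 : \sum_(i < p.+1) w k' l' i * yr i = (k%:R - l'%:R) * (y p - y 0%N).
    move: Csum; rewrite !(level_sumE _ _ y) (level_sumE _ _ yr) => Csum.
    have -> : \sum_(i < q.+2) yr i.+1 = \sum_(i < q.+2) y i.+1.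
      rewrite [RHS](reindex_inj rev_ord_inj) /=; apply: eq_bigr => i _.
      by rewrite /yr !subSS subSn // -ltnS.
    rewrite /yr subnn subn0.
    have -> : (k%:R - l'%:R) * (y p - y 0%N) = (k'%:R - l%:R) * y p - (k%:R - l'%:R) * y 0%N.
      by have -> : k'%:R - l%:R = k%:R - l'%:R :> R; [move: klR; lra | ring].
    by move: Csum; lra.
  rewrite (sum_level x brT.1).
  rewrite (eq_bigr (fun i : 'I_p.+1 => c1 * (w k' l' i * y i) + c2 * (w k' l' i * yr i))) => [|i _].
    by rewrite big_split -!mulr_sumr E1 E2 /c1 /c2 /=; ring.
  by rewrite /x; ring.
have xform : level_form a k' l' x x < 0.
  have -> : level_form a k' l' x x = c1 ^+ 2 * level_form a k' l' y y
     + 2 * c1 * c2 * level_form a k' l' yr y + c2 ^+ 2 * level_form a k' l' yr yr.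
    rewrite level_formDZl ![level_form a k' l' _ x]level_formC !level_formDZl.
    by rewrite [level_form a k' l' y yr]level_formC; ring.
  rewrite Qyy Qyr Qrr mulr0 addr0.
  have d0 : 0 < b * (y p ^+ 2 - y 0%N ^+ 2).
    rewrite mulr_gt0 // subr_gt0 -[X in _ < X]sqrrN ltr_sqr ?nnegrE ?(ltW y0) //.
    by rewrite oppr_ge0 ltW.
  rewrite !mulrN -opprD oppr_lt0 addr_gt0 //.
    by rewrite mulr_gt0 ?exprn_gt0 // mulr_gt0.
  by rewrite /c2 sqrrN mulr_gt0 ?exprn_gt0 // mulr_gt0.
rewrite ltNge; apply/negP => aT; move: xform; apply/negP; rewrite -leNgt.
rewrite (level_formE _ _ _ brT) subr_ge0.
apply: le_trans (algebraic_connectivity_le T1 xsum).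
rewrite (eq_bigr (fun u => x (ellT u) ^+ 2)) => [|u _]; last by rewrite expr2.
by rewrite ler_wpM2r // sumr_ge0 // => u _; rewrite sqr_ge0.
Qed.
End Balance.

(** * Domination and distances *)

Local Close Scope ring_scope.

Lemma dominatingP (G : sgraph) (S : {set G}) :
  reflect (forall v, exists2 u, u \in S & (u == v) || adj v u) (dominating S).
Proof.
apply: (iffP forallP) => [H v | H v].
  have [vS|vS] := boolP (v \in S); first by exists v; rewrite ?eqxx.
  by have /existsP [u /andP [uS vu]] := implyP (H v) vS; exists u; rewrite ?vu ?orbT.
apply/implyP => vS; have [u uS /orP [/eqP uv|vu]] := H v; first by rewrite -uv uS in vS.
by apply/existsP; exists u; rewrite uS.
Qed.

Lemma domination_numberP (G : sgraph) :
  (exists2 S : {set G}, dominating S & #|S| = domination_number G) /\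
  (forall S : {set G}, dominating S -> domination_number G <= #|S|).
Proof.
have domT : dominating [set: G] by apply/dominatingP => v; exists v; rewrite ?inE ?eqxx.
rewrite /domination_number; case: arg_minnP => // S domS minS.
by split; first by exists S.
Qed.

Lemma packing_le (T : finType) (S : {set T}) (h : T -> nat) m :
  (forall j, j < m -> exists2 s, s \in S & h s = j) -> m <= #|S|.
Proof.
move=> hS; have H (j : 'I_m) : exists s, (s \in S) && (h s == j).
  by have [s sS hs] := hS j (ltn_ord j); exists s; rewrite sS hs eqxx.
pose F j := xchoose (H j).
have FP j : (F j \in S) && (h (F j) == j) by apply: xchooseP (H j).
have Finj : injective F.
  have hF j : h (F j) = j by case/andP: (FP j) => _ /eqP.
  by move=> i j Fij; apply: val_inj => /=; rewrite -(hF i) Fij hF.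
rewrite -(card_ord m) -(card_codom Finj); apply: subset_leq_card.
by apply/subsetP => s /codomP [j ->]; case/andP: (FP j).
Qed.

Section Distance.
Variables (G : sgraph) (u : G).
Hypothesis Gconn : connected G.

Let reach (m : nat) (v : G) : bool :=
  [exists t : m.-tuple G, path (@adj G) u t && (last u t == v)].

Let reachP m v : reflect (exists t, [/\ path (@adj G) u t, last u t = v & size t = m])
  (reach m v).
Proof.
apply: (iffP existsP) => [[t /andP [pt /eqP lt]]|[t [pt lt st]]].
  by exists t; rewrite size_tuple.
by exists (Tuple (introT eqP st)) => /=; rewrite pt lt eqxx.
Qed.

Let reach_ex v : exists m, reach m v.
Proof.
have /connectP [t pt vt] := forallP (forallP Gconn u) v.
by exists (size t); apply/reachP; exists t.
Qed.

Definition dist v : nat := ex_minn (reach_ex v).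

Lemma dist_path v : exists t, [/\ path (@adj G) u t, last u t = v & size t = dist v].
Proof. by rewrite /dist; case: ex_minnP => m /reachP. Qed.

Lemma dist_min t : path (@adj G) u t -> dist (last u t) <= size t.
Proof. by move=> pt; rewrite /dist; case: ex_minnP => m _; apply; apply/reachP; exists t. Qed.

Lemma dist_adj v v' : adj v v' -> dist v' <= (dist v).+1.
Proof.
move=> vv'; have [t [pt lt st]] := dist_path v.
have := @dist_min (rcons t v'); rewrite last_rcons size_rcons st; apply.
by rewrite rcons_path pt lt.
Qed.

Lemma dist_onto x t i : path (@adj G) x t -> dist x <= i <= dist (last x t) ->
  exists v, dist v = i.
Proof.
elim: t x => [|y t IHt] x /= => [_|/andP [xy pt]] /andP [xi it].
  by exists x; apply/eqP; rewrite eqn_leq xi.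
move: xi; rewrite leq_eqVlt => /predU1P [xi|xi]; first by exists x.
by apply: (IHt y) => //; rewrite it (leq_trans (dist_adj xy)).
Qed.

(** Vertices at the distances [0, 3, 6, ...] from [u] are dominated by vertices
    whose distances to [u], up to an error of one, tell them apart. *)
Lemma dist_domination v : (dist v).+1 <= 3 * domination_number G.
Proof.
have [[S domS <-] _] := domination_numberP G.
suff : ((dist v) %/ 3).+1 <= #|S| by lia.
apply: (packing_le (h := fun s => (dist s).+1 %/ 3)) => j jv.
have [t [pt lt st]] := dist_path v.
have [x xj] : exists x, dist x = 3 * j.
  apply: (dist_onto pt); rewrite lt; apply/andP; split; last lia.
  by have := @dist_min [::] isT; rewrite /= leqn0 => /eqP ->.
have [s sS /orP [/eqP sx|xs]] := dominatingP _ domS x; exists s => //.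
  by rewrite sx xj; lia.
have sx : adj s x by rewrite adj_sym.
by have := dist_adj xs; have := dist_adj sx; lia.
Qed.

End Distance.

Lemma path_in_few_vertices (G : sgraph) (u v : G) : connected G ->
  exists2 t, path (@adj G) u t /\ last u t = v
    & #|[set x in u :: t]| <= 3 * domination_number G.
Proof.
move=> Gc; have [t [pt lt st]] := dist_path u Gc v.
exists t => //; apply: leq_trans (dist_domination u Gc v).
by rewrite cardsE -st; apply: card_size.
Qed.

Lemma path_crossing (G : sgraph) (A : pred G) x t : path (@adj G) x t ->
  A x -> ~~ A (last x t) ->
  exists y z, [/\ y \in x :: t, z \in x :: t, adj y z, A y & ~~ A z].
Proof.
elim: t x => [|y t IHt] x /= => [_ -> //|/andP [xy pt] Ax Al].
have [Ay|Ay] := boolP (A y); last first.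
  by exists x, y; rewrite !inE !eqxx ?orbT.
have [y' [z' [yi zi yz Ay' Az']]] := IHt y pt Ay Al.
by exists y', z'; split=> //; rewrite inE ?yi ?zi orbT.
Qed.

Section BroomGraph.
Variables k l d : nat.
Hypothesis d_gt0 : 0 < d.
Local Notation T := (T_kld k l d).

Lemma T_kld_connected : connected T.
Proof.
pose r : T := inl (Ordinal d_gt0).
have csym : connect_sym (@adj T).
  by move=> x y; apply: sym_connect_sym; apply: adj_sym.
have rin i (id : i < d) : connect (@adj T) r (inl (Ordinal id)).
  elim: i id => [|i IHi] id; first by rewrite (bool_irrelevance id d_gt0).
  have id' : i < d by apply: ltnW.
  apply: connect_trans (IHi id') (connect1 _) => /=; by rewrite eqxx.
have rc v : connect (@adj T) r v.
  case: v => [[i id]|[i|i]]; first exact: rin.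
    exact: connect1.
  have dd : d.-1 < d by rewrite prednK.
  by apply: connect_trans (rin _ dd) (connect1 _); rewrite /= prednK.
by apply/forallP => x; apply/forallP => y; apply: connect_trans (rc y); rewrite csym.
Qed.

Lemma card_T_kld : #|T| = d + (k + l).
Proof. by rewrite !card_sum !card_ord. Qed.

End BroomGraph.

(** Every third vertex of the path, the two ends included, forms a dominating
    set; conversely these vertices have pairwise disjoint closed
    neighbourhoods. *)
Lemma T_kld_domination k l g : 1 < g ->
  domination_number (T_kld k l (3 * g - 2)) = g.
Proof.
move=> g1; set d := 3 * g - 2; set T := T_kld k l d.
have [[S domS SE] minS] := domination_numberP T.
apply/eqP; rewrite eqn_leq; apply/andP; split; last first.
  rewrite -SE.
  pose h (v : T) := match v with
    | inl i => i.+1 %/ 3 | inr (inl _) => 0 | inr (inr _) => g.-1 end.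
  apply: (packing_le (h := h)) => j jg.
  have jd : 3 * j < d by rewrite /d; lia.
  have [s sS sj] := dominatingP _ domS (inl (Ordinal jd) : T); exists s => //.
  case: s sS sj => [i|[i|i]] _ /=.
  - by rewrite -[_ == _]/(i == Ordinal jd) -val_eqE /=; lia.
  - by move=> /eqP; lia.
  - by rewrite /d => /eqP; lia.
have pd (j : 'I_g) : 3 * j < d by have := ltn_ord j; rewrite /d; lia.
pose S0 : {set T} := [set (inl (Ordinal (pd j)) : T) | j : 'I_g].
have S0P i (id : i < d) : 3 %| i -> (inl (Ordinal id) : T) \in S0.
  move=> i3; have ig : i %/ 3 < g by rewrite /d in id; lia.
  apply/imsetP; exists (Ordinal ig) => //; congr inl; apply: val_inj => /=; lia.
have S0c : #|S0| <= g by apply: leq_trans (leq_imset_card _ _) _; rewrite card_ord.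
apply: leq_trans (minS S0 _) S0c; apply/dominatingP => -[[i id]|[i|i]].
- have : i %% 3 = 0 \/ i %% 3 = 1 \/ i %% 3 = 2 by lia.
  case=> [i0|[i1|i2]].
  + by exists (inl (Ordinal id)); rewrite ?eqxx //; apply: S0P; lia.
  + have id' : i.-1 < d by lia.
    exists (inl (Ordinal id')); first by apply: S0P; lia.
    by apply/orP; right => /=; lia.
  + have id' : i.+1 < d by rewrite /d in id *; lia.
    exists (inl (Ordinal id')); first by apply: S0P; lia.
    by apply/orP; right => /=; rewrite eqxx.
- have id' : 0 < d by rewrite /d; lia.
  by exists (inl (Ordinal id')); [apply: S0P | apply/orP; right].
have id' : d.-1 < d by rewrite /d; lia.
exists (inl (Ordinal id')); first by apply: S0P; rewrite /d; lia.
by apply/orP; right => /=; rewrite /d; lia.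
Qed.

Local Open Scope ring_scope.

(** * Extremality of the balanced double broom *)

(** The test sequence has the values [2 * c, c] at one end and [- b, - 2 * b]
    at the other, and zero in between. When [p = 3] an edge joins [c] to [- b]; its
    energy is bounded by [(c + b) ^ 2 <= 2 * c ^ 2 + 2 * b ^ 2]. *)
Lemma broom_connectivity_lt1 (R : rcfType) (G : sgraph) k l p (ell : G -> nat) :
  broom_leveling k l p ell -> (0 < k)%N -> (0 < l)%N -> (2 < p)%N ->
  algebraic_connectivity R G < 1.
Proof.
move=> brG k0 l0; case: p brG => [|[|[|q]]] // brG _.
have G1 : (1 < #|G|)%N by rewrite (broom_card (ltn0Sn _) brG.1); move: k0; clear; lia.
pose c : R := 2 * l%:R + 1; pose b : R := 2 * k%:R + 1.
pose x i := if i == 0%N then 2 * c else if i == 1%N then c else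
  if i == q.+2 then - b else if i == q.+3 then - (2 * b) else 0.
have kR : (1 : R) <= k%:R by rewrite ler1n.
have lR : (1 : R) <= l%:R by rewrite ler1n.
have c0 : 0 < c by rewrite /c; lra.
have b0 : 0 < b by rewrite /b; lra.
have x2 : x q.+2 = - b by rewrite /x /= eqxx.
have x1E : x 1%N = c by [].
have x3 : x q.+3 = - (2 * b) by rewrite /x /= eqxx gtn_eqF.
have xin i : (i < q)%N -> x i.+2 = 0.
  by move=> iq; rewrite /x /= !eqSS !ltn_eqF // ltnW.
have xsum : \sum_v x (ell v) = 0.
  rewrite (sum_level x brG.1) level_sumE big_ord_recl big_ord_recr /= big1 => [|i _]; last first.
    by rewrite /bump /= add1n xin.
  by rewrite /bump /= add1n x2 x3 /x /= /c /b; ring.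
have xnorm : 4 * k%:R * c ^+ 2 + c ^+ 2 + b ^+ 2 + 4 * l%:R * b ^+ 2
    <= \sum_v x (ell v) ^+ 2.
  rewrite (sum_level (fun i => x i ^+ 2) brG.1) (level_sumE _ _ _ (fun i => x i ^+ 2)).
  rewrite big_ord_recl big_ord_recr /= /bump /= add1n x2 x3.
  have : 0 <= \sum_(i < q) x (1 + i).+1 ^+ 2 by apply: sumr_ge0 => i _; rewrite sqr_ge0.
  by rewrite {2 3}/x /=; lra.
have xen : dirichlet (x \o ell) (x \o ell)
    <= k%:R * c ^+ 2 + 2 * c ^+ 2 + 2 * b ^+ 2 + l%:R * b ^+ 2.
  rewrite (level_dirichlet brG.1 brG.2).
  rewrite (edge_sumE _ _ _ (fun i => (x i - x i.+1) * (x i - x i.+1))) x2 x3.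
  have -> : x 0%N = 2 * c by [].
  rewrite x1E.
  suff : \sum_(i < q.+1) (x i.+1 - x i.+2) * (x i.+1 - x i.+2) <= 2 * c ^+ 2 + 2 * b ^+ 2.
    by lra.
  case: (posnP q) => [q0|q0].
    have x2' : x 2 = - b by rewrite -x2 q0.
    rewrite q0 big_ord1 x2' x1E; have := sqr_ge0 (c - b); lra.
  rewrite -(prednK q0) big_ord_recl big_ord_recr /= big1 => [|i _]; last first.
    have iq : (i.+1 < q)%N by rewrite -[X in (_ < X)%N](prednK q0) ltnS.
    by rewrite /bump /= add1n !xin ?subrr ?mul0r // ltnW.
  rewrite /bump /= add1n (prednK q0) x2 -[in x q.+1](prednK q0) !xin ?prednK //.
  rewrite x1E; have := sqr_ge0 c; have := sqr_ge0 b; lra.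
have xpos : 0 < \sum_v x (ell v) ^+ 2.
  by apply: lt_le_trans xnorm; have := sqr_ge0 c; have := sqr_ge0 b; nra.
have := le_trans (algebraic_connectivity_le G1 xsum) xen => le1.
rewrite ltNge; apply/negP => a1.
have : \sum_v x (ell v) ^+ 2 <= k%:R * c ^+ 2 + 2 * c ^+ 2 + 2 * b ^+ 2 + l%:R * b ^+ 2.
  by apply: le_trans le1; rewrite ler_peMl // ltW.
have kc : c ^+ 2 <= k%:R * c ^+ 2 by rewrite ler_peMl ?sqr_ge0.
have lb : b ^+ 2 <= l%:R * b ^+ 2 by rewrite ler_peMl ?sqr_ge0.
have : 0 < c ^+ 2 by rewrite exprn_gt0.
by have := sqr_ge0 b; move: xnorm kc lb; lra.
Qed.

(** The vertices of a path from a maximum to a minimum, completed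
    arbitrarily to the required number: extra vertices do no harm as they only
    refine the gaps that the path has to cross. *)
Lemma spine_exists (R : rcfType) (G : sgraph) (f : G -> R) p :
  (p < #|G|)%N ->
  (forall u v : G, exists2 t, path (@adj G) u t /\ last u t = v
     & (#|[set x in u :: t]| <= p.+1)%N) ->
  exists s u0 w0 U D, spine f s u0 w0 U D /\ size s = p.+1.
Proof.
move=> pG Gpath; have /card_gt0P [g _] := leq_ltn_trans (leq0n p) pG.
have [u0 _ /= umax] := @Order.TotalTheory.arg_maxP _ _ _ g xpredT f isT.
have [w0 _ /= wmin] := @Order.TotalTheory.arg_minP _ _ _ g xpredT f isT.
have [t [pt lt] ct] := Gpath u0 w0.
pose X := [set x in u0 :: t].
pose E := [set x in take (p.+1 - #|X|) (enum (~: X))].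
pose P := X :|: E.
have EX : [disjoint X & E].
  rewrite disjoint_sym disjoints_subset; apply/subsetP => x; rewrite inE => /mem_take.
  by rewrite mem_enum.
have cE : #|E| = (p.+1 - #|X|)%N.
  rewrite cardsE (card_uniqP _); last by rewrite take_uniq ?enum_uniq.
  by rewrite size_takel // -cardE leq_subLR cardsC.
have cP : #|P| = p.+1.
  by rewrite cardsU (disjoint_setI0 EX) cards0 subn0 cE subnKC.
pose s := sort (fun x y => f y <= f x) (enum P).
have ms x : (x \in s) = (x \in P) by rewrite mem_sort mem_enum.
have Xs x : x \in u0 :: t -> x \in s by move=> xt; rewrite ms in_setU [x \in X]inE xt.
exists s, u0, w0, [set v | (v \notin s) && (0 < f v)], [set v | (v \notin s) && (f v <= 0)].
split; last by rewrite size_sort -cardE.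
split.
- by rewrite sort_uniq enum_uniq.
- by apply: sort_sorted => x y; apply: le_total.
- by apply: Xs; rewrite mem_head.
- by move=> v; apply: umax.
- by apply: Xs; rewrite -lt mem_last.
- by move=> v; apply: wmin.
- move=> A Au Aw; rewrite -lt in Aw.
  have [x [y [xt yt xy Ax Ay]]] := path_crossing pt Au Aw.
  by exists x, y; split=> //; apply: Xs.
- by move=> v; rewrite !inE; case: (v \in s) => //=; case: ltgtP.
- by move=> v; rewrite inE => /andP [_ /ltW].
- by move=> v; rewrite inE => /andP [].
Qed.

Section Extremal.
Variables (R : rcfType) (G T : sgraph) (k0 l0 p : nat) (ellT : T -> nat).
Hypothesis brT : broom_leveling k0 l0 p ellT.
Hypotheses (k0_gt0 : (0 < k0)%N) (l0_gt0 : (0 < l0)%N) (p_gt2 : (2 < p)%N).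
Hypotheses (k0l0 : (l0 <= k0)%N) (l0k0 : (k0 <= l0.+1)%N).
Hypothesis cardG : #|G| = #|T|.
Hypothesis Gconn : connected G.
Hypothesis aGT : algebraic_connectivity R G <= algebraic_connectivity R T.
Local Notation a := (algebraic_connectivity R G).

Let p_gt0 : (0 < p)%N. Proof. exact: ltnW (ltnW p_gt2). Qed.
Let cardG' : #|G| = (k0 + l0 + p.-1)%N.
Proof. by rewrite cardG (broom_card p_gt0 brT.1). Qed.
Let G1 : (1 < #|G|)%N. Proof. by rewrite cardG'; lia. Qed.
Let a_gt0 : 0 < a. Proof. exact: algebraic_connectivity_gt0. Qed.
Let a_lt1 : a < 1.
Proof. exact: le_lt_trans aGT (broom_connectivity_lt1 R brT k0_gt0 l0_gt0 p_gt2). Qed.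

Lemma broom_exists k l : (0 < k)%N -> (0 < l)%N ->
  exists (B : sgraph) (ellB : B -> nat), connected B /\ broom_leveling k l p ellB.
Proof.
move=> k_gt0 l_gt0; exists (T_kld k l p.-1), (@broom_level k l p.-1).
have d1 : (1 < p.-1)%N by move: p_gt2; clear; lia.
split; first by apply: T_kld_connected; apply: ltnW.
have := T_kld_leveling k l d1; rewrite /broom_depth k_gt0 l_gt0.
have -> : maxn k 1 = k by apply/maxn_idPl.
have -> : maxn l 1 = l by apply/maxn_idPl.
by have -> : (p.-2 + true + true)%N = p by move: p_gt2; clear; lia.
Qed.

Lemma unbalanced_lt (B : sgraph) k l (ellB : B -> nat) : connected B ->
  broom_leveling k l p ellB -> (0 < l)%N -> (l.+1 < k)%N -> #|B| = #|G| ->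
  algebraic_connectivity R B <= a -> False.
Proof.
move=> Bc brB l_gt0 lk cB aB;
have kl : (k + l = k0 + l0)%N.
  by move: cB; rewrite cardG' (broom_card p_gt0 brB.1); move: p_gt0; clear; lia.
case: p p_gt2 brT brB => [|[|[|q]]] // _ brT' brB.
have B1 : (1 < #|B|)%N by rewrite cB.
have aB0 := algebraic_connectivity_gt0 R B1 Bc.
have k0k : (k0 < k)%N by move: kl k0l0 l0k0 lk; clear; lia.
have l0k : (l0 < k)%N by move: kl k0l0 l0k0 lk; clear; lia.
have := balance_decreases brB brT' l_gt0 k0_gt0 l0_gt0 kl k0k l0k aB0 (le_lt_trans aB a_lt1).
by rewrite ltNge (le_trans aB aGT).
Qed.

(** By [spine_bound] and [balance_decreases], the double broom obtained from
    the spine cannot be unbalanced; hence it is [T] up to reversal, and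
    the comparison with [T] is an equality. *)
Lemma spine_leveling_exists (f : G -> R) s u0 w0 (U D : {set G}) :
  spine f s u0 w0 U D -> size s = p.+1 ->
  (forall u, lap f u = a * f u) -> \sum_u f u = 0 -> 0 < f u0 -> f w0 < 0 ->
  0 <= \sum_(j < p.+1) (level_size #|U|.+1 #|D|.+1 p j)%:R * f (nth u0 s j) ->
  exists ell : G -> nat, leveling k0 l0 p ell.
Proof.
move=> sp sz feig fsum fu fw tot; set k := #|U|.+1 in tot *; set l := #|D|.+1 in tot *.
have kl : (k + l = k0 + l0)%N.
  have : (#|G| = p.+1 + #|U| + #|D|)%N.
    have := spine_sum sp sz (fun=> 1 : R); rewrite !sumr_const card_ord.
    by rewrite -!natrD => /eqP; rewrite eqr_nat => /eqP.
  by rewrite cardG' /k /l; move: p_gt0; clear; lia.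
have [kE|[kE|[kE|kE]]] : (k = k0 /\ l = l0) \/ (k = l0 /\ l = k0) \/ (l.+1 < k)%N \/ (k.+1 < l)%N.
  by move: kl k0l0 l0k0; clear; lia.
- case: kE => kE lE; rewrite -/k -/l kE lE in tot.
  have brT' : broom_leveling k l p ellT by rewrite kE lE.
  rewrite -kE -lE in tot *.
  exact: (spine_bound sp sz p_gt2 a_gt0 a_lt1 feig fsum fu fw brT' tot).2 aGT.
- case: kE => kE lE.
  have brT' : broom_leveling k l p (fun v => (p - ellT v)%N).
    by rewrite kE lE; apply: broom_leveling_rev.
  have [_ /(_ aGT) [ell lv]] := spine_bound sp sz p_gt2 a_gt0 a_lt1 feig fsum fu fw brT' tot.
  exists (fun v => (p - ell v)%N); rewrite -kE -lE; exact: leveling_rev.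
- have [B [ellB [Bc brB]]] := broom_exists (ltn0Sn #|U|) (ltn0Sn #|D|).
  have [aB _] := spine_bound sp sz p_gt2 a_gt0 a_lt1 feig fsum fu fw brB tot.
  exfalso; apply: (unbalanced_lt Bc brB) aB => //.
  by rewrite (broom_card p_gt0 brB.1) cardG' -kl.
have [B [ellB [Bc brB]]] := broom_exists (ltn0Sn #|U|) (ltn0Sn #|D|).
have [aB _] := spine_bound sp sz p_gt2 a_gt0 a_lt1 feig fsum fu fw brB tot.
exfalso; apply: (unbalanced_lt Bc (broom_leveling_rev p_gt0 brB)) aB => //.
by rewrite (broom_card p_gt0 brB.1) cardG' -kl.
Qed.

(** Replacing [f] by its opposite exchanges the two ends of the spine, which
    gives the sign condition required by [spine_leveling_exists]. *)
Lemma extremal_leveling :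
  (forall u v : G, exists2 t, path (@adj G) u t /\ last u t = v
     & (#|[set x in u :: t]| <= p.+1)%N) ->
  exists ell : G -> nat, leveling k0 l0 p ell.
Proof.
move=> Gpath; have [f [[v fv] fsum feig]] := fiedler_vector R G1.
have pG : (p < #|G|)%N by rewrite cardG'; move: k0_gt0 l0_gt0; clear; lia.
have [s [u0 [w0 [U [D [sp sz]]]]]] := spine_exists f pG Gpath.
have fw : f w0 < 0.
  rewrite ltNge; apply/negP => fw; move/eqP: fv; apply.
  by apply: (psumr_eq0P _ fsum) => // u _; apply: le_trans fw (spine_min sp u).
have fu : 0 < f u0.
  rewrite ltNge; apply/negP => fu; move/eqP: fv; apply; apply/eqP.
  rewrite -oppr_eq0; apply/eqP.
  apply: (psumr_eq0P (P := xpredT) (F := fun u => - f u)) => //.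
    by move=> u _; rewrite oppr_ge0 (le_trans (spine_max sp u)).
  by rewrite sumrN fsum oppr0.
have [tot|tot] := lerP 0 (\sum_(j < p.+1) (level_size #|U|.+1 #|D|.+1 p j)%:R * f (nth u0 s j)).
  exact: spine_leveling_exists sp sz feig fsum fu fw tot.
have sz' : size (rev s) = p.+1 by rewrite size_rev.
apply: (spine_leveling_exists (spine_opp sp) sz').
- by move=> u; rewrite mulrN -feig /lap -sumrN; apply: eq_bigr => w _; rewrite opprB addrC opprK.
- by rewrite sumrN fsum oppr0.
- by rewrite oppr_gt0.
- by rewrite oppr_lt0.
have p1 := ltnW p_gt2.
have := spine_total (fun v => - f v) w0 D U sz' p1; rewrite /= => ->.
move: tot; rewrite (spine_total _ u0 U D sz p1).
have := spine_Y0 (spine_opp sp) sz'; have := spine_Yp (spine_opp sp) sz'; rewrite /= => -> ->.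
rewrite (spine_Y0 sp sz) (spine_Yp sp sz).
have -> : \sum_(j < p.+1) - f (nth w0 (rev s) j) = - \sum_(j < p.+1) f (nth u0 s j).
  rewrite -sumrN [RHS](reindex_inj rev_ord_inj) /=; apply: eq_bigr => j _.
  by rewrite nth_rev sz ?ltn_ord // (set_nth_default u0) // sz subSS ltnS leq_subr.
by lra.
Qed.

End Extremal.

(** * Graphs with a dominating vertex *)

Section DominatingVertex.
Variables (R : rcfType) (G : sgraph) (v : G).
Hypothesis vdom : forall w : G, w != v -> adj v w.
Hypothesis G_gt2 : (2 < #|G|)%N.
Hypothesis a_le1 : algebraic_connectivity R G <= 1.
Local Notation a := (algebraic_connectivity R G).

(** A Fiedler vector [f] vanishes at [v]. At a maximum [x] of [f] the edge to
    [v] alone accounts for the whole of [f x], which is at least [a * f x]; so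
    the other neighbours of [x] carry no flux, and the set of maxima is closed
    under adjacency in the graph without [v]. *)
Lemma dominating_vertex_closed_part : exists (A : pred G) (x y : G),
  [/\ A x, x != v, ~~ A y, y != v
    & forall z t, A z -> t != v -> adj z t -> A t].
Proof.
have G1 : (1 < #|G|)%N by apply: ltnW.
have [f [[u fu] fsum feig]] := fiedler_vector R G1.
have fv : f v = 0.
  have : lap f v = #|G|%:R * f v.
    transitivity (\sum_w (f v - f w)).
      rewrite /lap big_mkcond; apply: eq_bigr => w _.
      by have [->|/vdom ->] := eqVneq w v; rewrite ?adj_irrefl ?subrr.
    by rewrite sumrB fsum subr0 sumr_const mulr_natl.
  rewrite feig => /eqP; rewrite -subr_eq0 -mulrBl mulf_eq0 => /orP [|/eqP //].
  rewrite subr_eq0 => /eqP aE; move: a_le1; rewrite aE lern1; move: G_gt2; clear; lia.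
have [x _ /= xmax] := @Order.TotalTheory.arg_maxP _ _ _ v xpredT f isT.
have [y _ /= ymin] := @Order.TotalTheory.arg_minP _ _ _ v xpredT f isT.
have fx : 0 < f x.
  rewrite ltNge; apply/negP => fx; move/eqP: fu; apply; apply/eqP.
  rewrite -oppr_eq0; apply/eqP.
  apply: (psumr_eq0P (P := xpredT) (F := fun u => - f u)) => //.
    by move=> w _; rewrite oppr_ge0 (le_trans (xmax w isT)).
  by rewrite sumrN fsum oppr0.
have fy : f y < 0.
  rewrite ltNge; apply/negP => fy; move/eqP: fu; apply.
  by apply: (psumr_eq0P _ fsum) => // w _; apply: le_trans fy (ymin w isT).
exists [pred w | f w == f x], x, y; split.
- by rewrite /= eqxx.
- by apply: contraTneq fx => ->; rewrite fv ltxx.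
- by rewrite /= lt_eqF // (lt_trans fy).
- by apply: contraTneq fy => ->; rewrite fv ltxx.
move=> z t /= /eqP fz tv zt.
have zv : adj z v.
  rewrite adj_sym; apply: vdom; apply: contraTneq fx => zv.
  by rewrite -fz zv fv ltxx.
have ge0 w : 0 <= f z - f w by rewrite fz subr_ge0 xmax.
have := feig z; rewrite /lap (bigD1 v) //= (bigD1 t) /= ?zt // fv subr0.
have : 0 <= \sum_(w | adj z w && (w != v) && (w != t)) (f z - f w) by apply: sumr_ge0.
have : a * f z <= f z by rewrite ler_piMl // fz ltW.
move=> h1 h2 h3; rewrite eq_le xmax //= -subr_le0 -fz.
by move: h1 h2 h3; lra.
Qed.

Lemma dominating_cut_vertex : connected G -> cut_vertex v.
Proof.
move=> Gc; have [A [x [y [Ax xv Ay yv Acl]]]] := dominating_vertex_closed_part.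
have csym : connect_sym (@adj G) by apply: sym_connect_sym; apply: adj_sym.
rewrite /cut_vertex.
have -> : n_comp (@adj G) [set: G] = 1%N.
  rewrite -(n_comp_connect csym v); apply: eq_n_comp_r => w.
  by rewrite inE; apply/esym; apply: (forallP (forallP Gc v)).
set e := vertex_deleted v.
have esym : symmetric e by move=> z t; rewrite /e /vertex_deleted /= adj_sym andbCA.
have ecsym : connect_sym e by apply: sym_connect_sym.
have rv z : z != v -> fingraph.root e z != v.
  move=> zv; have /connectP [t pt ->] := connect_root e z.
  elim: t z zv pt => //= t s IHs z zv /andP [/and3P [_ tv _] pt]; exact: IHs.
have connA z t : A z -> connect e z t -> A t.
  move=> Az /connectP [s ps ->]; elim: s z Az ps => //= w s IHs z Az /andP [/and3P [_ wv zw] pw].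
  by apply: IHs pw; apply: Acl zw.
have rxy : fingraph.root e x != fingraph.root e y.
  apply: contra Ay => /eqP; move/(fingraph.rootP ecsym); exact: connA.
rewrite /n_comp_mem; unlock; rewrite (cardD1 (fingraph.root e x)) (cardD1 (fingraph.root e y)).
by rewrite !inE /= !(roots_root ecsym) !rv // eq_sym rxy.
Qed.

End DominatingVertex.

(** Test vector: opposite values at two pendant vertices. *)
Lemma star_connectivity_le1 (R : rcfType) n : (2 < n)%N ->
  algebraic_connectivity R (T_kld n.-1 0 1) <= 1.
Proof.
move=> n2; have h0 : (0 < n.-1)%N by move: n2; clear; lia.
have h1 : (1 < n.-1)%N by move: n2; clear; lia.
set T := T_kld _ _ _.
pose A : T := inr (inl (Ordinal h0)); pose B : T := inr (inl (Ordinal h1)).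
pose c : T := inl ord0.
pose x (u : T) : R := (u == A)%:R - (u == B)%:R.
have sumE (z : T) (F : T -> R) : \sum_u (u == z)%:R * F u = F z.
  rewrite (bigD1 z) //= eqxx mul1r big1 ?addr0 // => u /negbTE ->.
  by rewrite mul0r.
have sumx (F : T -> R) : \sum_u x u * F u = F A - F B.
  rewrite -(sumE A F) -(sumE B F) -sumrB; apply: eq_bigr => u _.
  by rewrite /x mulrBl.
have lapx z : adj z =1 pred1 c -> x c = 0 -> lap x z = x z.
  by move=> zc xc; rewrite /lap (eq_bigl _ _ zc) big_pred1_eq xc subr0.
have adjc i : adj (inr (inl i) : T) =1 pred1 c.
  case=> [j|[j|j]] //=; rewrite (ord1 j) eqxx; apply/esym/eqP; congr inl.
have xc : x c = 0 by rewrite /x subrr.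
have xA : x A = 1 by rewrite /x eqxx subr0.
have xB : x B = -1 by rewrite /x eqxx sub0r.
have T1 : (1 < #|T|)%N by rewrite card_T_kld; move: n2; clear; lia.
have xs : \sum_u x u = 0.
  by have := sumx (fun=> 1); rewrite subrr; apply: etrans; apply: eq_bigr => u _; rewrite mulr1.
have := algebraic_connectivity_le T1 xs.
have -> : \sum_u x u ^+ 2 = 2.
  transitivity (\sum_u x u * x u); first by apply: eq_bigr => u _; rewrite expr2.
  by rewrite sumx xA xB; ring.
rewrite /dirichlet sumx !lapx //; try exact: adjc.
rewrite xA xB; lra.
Qed.

Lemma star_class n : (2 < n)%N -> conn_dom_class n 1 (T_kld n.-1 0 1).
Proof.
move=> n2; split; first by rewrite card_T_kld; move: n2; clear; lia.
  exact: T_kld_connected.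
set T := T_kld _ _ _.
have [[S domS SE] minS] := domination_numberP T.
apply/eqP; rewrite eqn_leq; apply/andP; split.
  rewrite -(cards1 (inl ord0 : T)); apply: minS; apply/dominatingP => u.
  exists (inl ord0); rewrite ?inE //; case: u => [i|[i|[]//]] //=.
  by rewrite (ord1 i) eqxx.
rewrite -SE card_gt0; apply/set0Pn.
by have [u uS _] := dominatingP _ domS (inl ord0); exists u.
Qed.

(** * From levels to isomorphisms *)

Section LevelIsomorphism.
Variables (G T : sgraph) (k l p : nat) (ell : G -> nat) (ellT : T -> nat).
Hypothesis lvG : leveling k l p ell.
Hypothesis brT : broom_leveling k l p ellT.
Hypothesis p_gt2 : (2 < p)%N.

Let p_gt0 : (0 < p)%N. Proof. exact: ltnW (ltnW p_gt2). Qed.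

Lemma level_matching (G1 G2 : sgraph) (ell1 : G1 -> nat) (ell2 : G2 -> nat) :
  leveling k l p ell1 -> leveling k l p ell2 ->
  exists f : G1 -> G2, exists g : G2 -> G1,
  [/\ cancel f g, cancel g f & forall v, ell2 (f v) = ell1 v].
Proof.
move=> lv1 lv2; pose L1 i := enum [set v | ell1 v == i].
pose L2 i := enum [set v | ell2 v == i].
have sz i : (i <= p)%N -> size (L1 i) = size (L2 i).
  by move=> ip; rewrite -!cardE (level_card lv1 ip) (level_card lv2 ip).
have m1 v : v \in L1 (ell1 v) by rewrite mem_enum inE.
have m2 v : v \in L2 (ell2 v) by rewrite mem_enum inE.
have s1 v : (index v (L1 (ell1 v)) < size (L2 (ell1 v)))%N.
  by rewrite -sz ?(level_le lv1) // index_mem.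
have s2 v : (index v (L2 (ell2 v)) < size (L1 (ell2 v)))%N.
  by rewrite sz ?(level_le lv2) // index_mem.
have [g10|[d1 _]] := set_0Vmem [set: G1].
  have no1 (v : G1) : False by have := in_setT v; rewrite g10 inE.
  have no2 (v : G2) : False.
    have := s2 v; case E : (L1 _) => [//|x s]; case: (no1 x).
  by exists (fun v => False_rect _ (no1 v)), (fun v => False_rect _ (no2 v)); split=> v;
     case: (no1 v) || case: (no2 v).
have [g20|[d2 _]] := set_0Vmem [set: G2].
  have no2 (v : G2) : False by have := in_setT v; rewrite g20 inE.
  by have := s1 d1; case E : (L2 _) => [//|x s]; case: (no2 x).
pose f v := nth d2 (L2 (ell1 v)) (index v (L1 (ell1 v))).
pose g v := nth d1 (L1 (ell2 v)) (index v (L2 (ell2 v))).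
have fl v : ell2 (f v) = ell1 v.
  have : f v \in L2 (ell1 v) by apply: mem_nth.
  by rewrite mem_enum inE => /eqP.
have gl v : ell1 (g v) = ell2 v.
  have : g v \in L1 (ell2 v) by apply: mem_nth.
  by rewrite mem_enum inE => /eqP.
exists f, g; split=> // v.
  by rewrite /g fl /f index_uniq ?enum_uniq // nth_index.
by rewrite /f gl /g index_uniq ?enum_uniq // nth_index.
Qed.

Lemma broom_leaf_pair (T' : sgraph) k' l' (ell' : T' -> nat) x y :
  broom_leveling k' l' p ell' -> ell' x = 0%N -> ell' y = 0%N -> x != y ->
  [set x; y] \in pendant_star_pairs T'.
Proof.
move=> [lv nadj] x0 y0 xy.
have /eqP/cards1P [q qE] : #|[set v | ell' v == 1%N]| = 1%N.
  by rewrite (level_card lv) // /level_size /= ltn_eqF // ltnW.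
have leaf z : ell' z = 0%N -> adj z =1 pred1 q.
  move=> z0 v /=; have -> : (v == q) = (ell' v == 1%N) by rewrite -in_set1 -qE inE.
  have [zv|zv] := eqVneq (ell' z) (ell' v).
    by rewrite (negbTE (nadj _ _ zv)) -zv z0.
  by rewrite (level_adj lv zv) z0 /consecutive orbF eq_sym.
have pend z : ell' z = 0%N -> pendant z.
  move=> z0; rewrite /pendant /degree -(cards1 q); apply/eqP; congr #|pred_of_set _|.
  by apply/setP => v; rewrite !inE leaf.
have qadj z : ell' z = 0%N -> adj q z by move=> z0; rewrite adj_sym leaf /= ?eqxx.
rewrite inE cards2 xy eqxx /=; apply/existsP; exists q; apply/andP; split.
  by apply/existsP; exists x; rewrite pend // qadj.
apply/subsetP => z; rewrite !inE => /orP [] /eqP ->; by rewrite pend // qadj // orbT.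
Qed.

Lemma same_level_pair x y : ellT x = ellT y -> x != y ->
  [set x; y] \in pendant_star_pairs T.
Proof.
move=> xy nxy; have [x0|x0] := posnP (ellT x).
  by apply: broom_leaf_pair brT _ _ nxy; rewrite -?xy.
have [xp|xp] := leqP p (ellT x).
  have xE : ellT x = p by apply/eqP; rewrite eqn_leq xp (level_le brT.1).
  apply: broom_leaf_pair (broom_leveling_rev p_gt0 brT) _ _ nxy => /=.
    by rewrite xE subnn.
  by rewrite -xy xE subnn.
have /eqP/cards1P [q qE] : #|[set v | ellT v == ellT x]| = 1%N.
  by rewrite (level_card brT.1) ?(ltnW xp) // /level_size gtn_eqF // ltn_eqF.
have : x \in [set v | ellT v == ellT x] by rewrite inE.
have : y \in [set v | ellT v == ellT x] by rewrite inE xy.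
by rewrite qE !inE => /eqP yq /eqP xq; rewrite xq yq eqxx in nxy.
Qed.

(** Levels of equal size are matched arbitrarily; the additional edges of [G]
    are those inside a level. *)
Lemma leveling_isomorphic : exists2 E : {set {set T}},
  E \subset pendant_star_pairs T & isomorphic G (add_edges E).
Proof.
have [f [g [fg gf fl]]] := level_matching lvG brT.1.
pose E := [set e : {set T} | [exists x, exists y,
  [&& e == [set x; y], ellT x == ellT y & adj (g x) (g y)]]].
exists E.
  apply/subsetP => e; rewrite inE => /existsP [x /existsP [y /and3P [/eqP -> /eqP xy gxy]]].
  by apply: same_level_pair => //; apply: contraTneq gxy => ->; rewrite adj_irrefl.
exists f; first by exists g.
move=> x y; rewrite /= /add_edges_adj.
have [xy|xy] := eqVneq (ell x) (ell y); last first.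
  rewrite !(level_adj brT.1, level_adj lvG) ?fl //.
  case: (boolP (_ && _)) => [/andP [_]|_]; last by rewrite orbF.
  rewrite inE => /existsP [z /existsP [t /and3P [/eqP ezt /eqP zt _]]].
  have lev w : w \in [set z; t] -> ellT w = ellT z by rewrite !inE => /orP [] /eqP ->.
  have : ell x = ell y by rewrite -!fl !lev // -ezt !inE eqxx ?orbT.
  by move/eqP; rewrite (negbTE xy).
rewrite (negbTE (brT.2 _ _ _)) ?fl //= (inj_eq (can_inj fg)).
apply/andP/idP => [[nxy]|axy]; last first.
  split; first by apply: contraTneq axy => ->; rewrite adj_irrefl.
  rewrite inE; apply/existsP; exists (f x); apply/existsP; exists (f y).
  by rewrite eqxx !fl xy !fg axy !eqxx.
rewrite inE => /existsP [z /existsP [t /and3P [/eqP ezt _ gzt]]].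
have zt : z != t by apply: contraTneq gzt => ->; rewrite adj_irrefl.
have : z \in [set f x; f y] by rewrite ezt !inE eqxx.
have : t \in [set f x; f y] by rewrite ezt !inE eqxx orbT.
rewrite !inE => /orP [] /eqP tE /orP [] /eqP zE; move: gzt zt; rewrite tE zE ?eqxx ?fg //.
by rewrite adj_sym.
Qed.

End LevelIsomorphism.

Lemma T_order_class n g : (1 < g)%N -> (3 * g - 2 <= n)%N ->
  conn_dom_class n g (T_order n (3 * g - 2)).
Proof.
move=> g1 gn; split; last exact: T_kld_domination.
  rewrite card_T_kld; have := uphalf_half (n - (3 * g - 2)); have := odd_double_half (n - (3 * g - 2)).
  by move: gn; clear; lia.
by apply: T_kld_connected; lia.
Qed.

(** A connected graph with domination number [g] has diameter at most
    [3 * g - 1], and the levels of [T_order n (3 * g - 2)] number either [n] or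
    [3 * g], whichever is smaller. *)
Lemma minimizing_isomorphic (R : rcfType) (n g : nat) (G : sgraph) :
  (1 < g)%N -> (3 * g - 2 <= n)%N -> minimizing R n g G ->
  exists2 E : {set {set T_order n (3 * g - 2)}},
    E \subset pendant_star_pairs (T_order n (3 * g - 2))
    & isomorphic G (add_edges E).
Proof.
move=> g1 gn [[cG Gc dG] minG].
have Tcl := T_order_class g1 gn.
have aGT := minG _ Tcl; have [cT _ _] := Tcl.
set d := (3 * g - 2)%N in gn aGT cT Tcl *.
have d4 : (3 < d)%N by rewrite /d; move: g1; clear; lia.
have brT := T_kld_leveling (uphalf (n - d)) (n - d)./2 (ltnW (ltnW d4)).
set k := uphalf (n - d) in brT *; set l := (n - d)./2 in brT *.
have kl : (k + l = n - d)%N /\ (l <= k <= l.+1)%N.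
  rewrite /k /l uphalf_half; have := odd_double_half (n - d); case: odd => /=; lia.
set p := broom_depth _ _ _ in brT.
have p2 : (2 < p)%N by rewrite /p /broom_depth; move: d4; clear; lia.
have [ell lv] : exists ell : G -> nat, leveling (maxn k 1) (maxn l 1) p ell.
  apply: (extremal_leveling (R := R) brT) => //; try by rewrite leq_max orbT.
  - by move: kl; clear; lia.
  - by move: kl; clear; lia.
  - by rewrite cG cT.
  move=> u v; have [t tP ct] := path_in_few_vertices u v Gc; exists t => //.
  have := leq_trans (max_card [set x in u :: t]) (eq_leq cG).
  move: ct kl; rewrite dG /p /broom_depth /d; move: gn g1; rewrite /d; clear.
  by case: (ltnP 0 k) => ?; case: (ltnP 0 l) => ? ; lia.
exact: leveling_isomorphic lv brT p2.
Qed.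

Local Close Scope ring_scope.

Theorem theorem3p9 (R : realType) (n gamma : nat) (G : sgraph)
    (n_gt0 : 0 < n) (gamma_gt0 : 0 < gamma)
    (le_gamma_n : 3 * gamma - 2 <= n)
    (minG : minimizing R n gamma G) :
  (gamma = 1 -> 2 < n ->
     exists v : G, cut_vertex v /\ forall w : G, w != v -> adj v w)
  /\
  (2 <= gamma ->
     exists2 E : {set {set T_order n (3 * gamma - 2)}},
       E \subset pendant_star_pairs (T_order n (3 * gamma - 2))
       & isomorphic G (add_edges E)).
Proof.
split=> [gamma1 n_gt2|gamma_gt1]; last exact: minimizing_isomorphic minG.
rewrite gamma1 in minG; have [[cG Gc dG] aG] := minG.
have aG1 := le_trans (aG _ (star_class n_gt2)) (star_connectivity_le1 R n_gt2).
have [S domS] := (domination_numberP G).1.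
rewrite dG => /eqP/cards1P [v Sv].
have vdom w : w != v -> adj v w.
  have [u] := dominatingP _ domS w.
  by rewrite Sv inE adj_sym => /eqP -> /orP [/eqP ->|//]; rewrite eqxx.
by exists v; split=> //; apply: dominating_cut_vertex vdom _ aG1 Gc; rewrite cG.
Qed.
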